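(* Let $d \ge 2$, let $C \subset \mathbb{R}^d$ be a convex body, let $r_0 \in \partial C$ be a regular point of $\partial C$, and let $e$ be the outward unit normal vector to the plane of support $\Pi$ to $C$ at $r_0$. For small $t>0$ let $\nu_t$ be the normalized surface area measure on $S^{d-1}$ induced by $S_t$, that is, $\nu_t = \frac{1}{|B_t|}\,\nu_{S_t}$. Then $\nu_t$ converges weakly to the unit atom at $e$: $$\lim_{t\to 0^+} \nu_t = \delta_e .$$
   Context: A convex body is a compact convex set with nonempty interior. A ''plane'' in $\mathbb{R}^d$ is a hyperplane. $\langle\cdot,\cdot\rangle$ is the scalar product. $|\cdot|_m$ denotes $m$-dimensional Hausdorff measure (normalized as the usual $m$-dimensional volume), and $|\cdot| = |\cdot|_{d-1}$. A point $r\in\partial C$ is regular if the plane of support to $C$ at $r$ is unique; then $n_r$ denotes the outward unit normal to $C$ at $r$. Regular points form a full-measure subset of $\partial C$. $\Pi$ is a plane of support to $C$ at $r_0$ with outward unit normal $e$, so $\langle r-r_0,e\rangle \le 0$ for all $r\in C$. For $t>0$ set $$B_t = C\cap\{r:\langle r-r_0,e\rangle=-t\},\qquad S_t=\partial C\cap\{r:\langle r-r_0,e\rangle\ge -t\}.$$ For all sufficiently small $t>0$ one has $0<|B_t|<\infty$. For a Borel set $S\subset\partial C$, the surface area measure induced by $S$ is the Borel measure $\nu_S$ on $S^{d-1}$ given by $\nu_S(\mathcal{A})=|\{r\in S: r \text{ is regular and } n_r\in\mathcal{A}\}|$ for Borel $\mathcal{A}\subset S^{d-1}$. Weak convergence $\lim_{t\to0}\nu_t=\nu_*$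 means $\int_{S^{d-1}} f\,d\nu_t\to\int_{S^{d-1}} f\,d\nu_*$ as $t\to0^+$ for every continuous function $f$ on $S^{d-1}$. $\delta_e$ is the unit point mass at $e$. *)

(* Defs.v *)
From mathcomp Require Import all_boot all_order all_algebra.
From mathcomp Require Import all_classical all_reals all_analysis.

Set Implicit Arguments.
Unset Strict Implicit.
Unset Printing Implicit Defensive.

Import Order.TTheory GRing.Theory Num.Theory.
Import numFieldNormedType.Exports.

Local Open Scope classical_set_scope.
Local Open Scope ring_scope.

(* The norm `|x| of 'rV[R]_d is the sup norm: it induces the usual topology,
   but lengths and diameters have to be taken with the Euclidean norm below. *)
Definition dotp (R : realType) (d : nat) (u v : 'rV[R]_d) : R :=
  (u *m v^T) 0 0.

Definition enorm (R : realType) (d : nat) (u : 'rV[R]_d) : R :=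
  Num.sqrt (dotp u u).

Definition usphere (R : realType) (d : nat) : set 'rV[R]_d :=
  [set u | enorm u = 1].

(* R^d with its Borel sigma-algebra; a Borel measure on the unit sphere is
   represented by a function on the Borel sets of R^d that only depends on the
   trace on the sphere. *)
Notation borel_rV R d := (g_sigma_algebraType (@open 'rV[R]_d)).

(* Since V_m = (2 pi / m) V_(m-2), with V_0 = 1 and V_1 = 2. *)
Fixpoint unit_ball_volume (R : realType) (m : nat) : R :=
  match m with
  | 0 => 1
  | 1 => 2
  | k.+2 => 2 * pi / k.+2%:R * unit_ball_volume R k
  end.

(* Equal to -oo on the empty set. *)
Definition ediam (R : realType) (d : nat) (A : set 'rV[R]_d) : \bar R :=
  ereal_sup [set (enorm (p.1 - p.2))%:E | p in A `*` A].

(* The empty set is set apart so that countable covers can be padded with it: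
   ediam set0 is -oo, and for m = 0 the general formula would give 1. *)
Definition hausdorff_gauge (R : realType) (d m : nat) (A : set 'rV[R]_d) :
    \bar R :=
  if A == set0 then 0%E
  else ((unit_ball_volume R m / 2 ^+ m)%:E * ediam A ^+ m)%E.

Definition hausdorff_content (R : realType) (d m : nat) (delta : R)
    (A : set 'rV[R]_d) : \bar R :=
  ereal_inf
    [set (\sum_(0 <= i <oo) hausdorff_gauge m (F i))%E |
      F in [set F : nat -> set 'rV[R]_d |
        A `<=` \bigcup_i F i /\ forall i, (ediam (F i) <= delta%:E)%E]].

Definition hausdorff_measure (R : realType) (d m : nat) (A : set 'rV[R]_d) :
    \bar R :=
  ereal_sup [set hausdorff_content m delta A | delta in [set x : R | 0 < x]].

Definition boundary (R : realType) (d : nat) (C : set 'rV[R]_d) :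
    set 'rV[R]_d :=
  closure C `\` interior C.

Definition convex_body (R : realType) (d : nat) (C : set 'rV[R]_d) : Prop :=
  [/\ compact C, convex_set C & interior C !=set0].

Definition hyperplane (R : realType) (d : nat) (r v : 'rV[R]_d) :
    set 'rV[R]_d :=
  [set x | dotp (x - r) v = 0].

Definition halfspace (R : realType) (d : nat) (r v : 'rV[R]_d) :
    set 'rV[R]_d :=
  [set x | dotp (x - r) v <= 0].

Definition support_plane (R : realType) (d : nat) (C : set 'rV[R]_d)
    (r : 'rV[R]_d) (P : set 'rV[R]_d) : Prop :=
  exists v, [/\ v != 0, P = hyperplane r v & C `<=` halfspace r v].

Definition outward_unit_normal (R : realType) (d : nat) (C : set 'rV[R]_d)
    (r : 'rV[R]_d) (P : set 'rV[R]_d) (n : 'rV[R]_d) : Prop :=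
  [/\ enorm n = 1, P = hyperplane r n & C `<=` halfspace r n].

Definition regular_point (R : realType) (d : nat) (C : set 'rV[R]_d)
    (r : 'rV[R]_d) : Prop :=
  boundary C r /\ exists! P, support_plane C r P.

(* The normal n_r; meaningful at regular points only. *)
Definition normal_at (R : realType) (d : nat) (C : set 'rV[R]_d)
    (r : 'rV[R]_d) : 'rV[R]_d :=
  xget 0 [set n | exists P, support_plane C r P /\ outward_unit_normal C r P n].

Definition cap_base (R : realType) (d : nat) (C : set 'rV[R]_d)
    (r0 e : 'rV[R]_d) (t : R) : set 'rV[R]_d :=
  C `&` [set r | dotp (r - r0) e = - t].

Definition cap_surface (R : realType) (d : nat) (C : set 'rV[R]_d)
    (r0 e : 'rV[R]_d) (t : R) : set 'rV[R]_d :=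
  boundary C `&` [set r | - t <= dotp (r - r0) e].

Definition surface_area_measure (R : realType) (d : nat) (C S : set 'rV[R]_d)
    (A : set (borel_rV R d)) : \bar R :=
  hausdorff_measure d.-1
    [set r | [/\ S r, regular_point C r & A (normal_at C r)]].

Definition normalized_cap_measure (R : realType) (d : nat)
    (C : set 'rV[R]_d) (r0 e : 'rV[R]_d) (t : R) (A : set (borel_rV R d)) :
    \bar R :=
  ((hausdorff_measure d.-1 (cap_base C r0 e t))^-1 *
   surface_area_measure C (cap_surface C r0 e t) A)%E.

Definition sphere_weak_cvg (R : realType) (d : nat)
    (nu : R -> set (borel_rV R d) -> \bar R)
    (mu : set (borel_rV R d) -> \bar R) : Prop :=
  forall f : 'rV[R]_d -> R, {within @usphere R d, continuous f} ->
    (\int[nu t]_(n in @usphere R d) (f n)%:E)%E @[t --> 0^'+] -->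
    (\int[mu]_(n in @usphere R d) (f n)%:E)%E.

(* Main.v *)
(* Near a regular point the body is flat: for every [K] the section [B_t]
   contains, for small [t], the ball of radius [K t] around [r0 - t e] in its
   plane. For [r] in the cap at height [h] in [[-t, 0]], with unit normal [n]
   making the angle [theta] with [e], let [y(r)] be the projection of [r] to the
   plane of [B_t], moved by [-h tan(theta / 2)] in the direction of the
   projection of [n]. Monotonicity of the normals makes [r |-> y(r)] distance
   increasing, so it does not decrease Hausdorff measure. Flatness shows that
   all [y(r)] lie in a homothetic copy of [B_t] of ratio [1 + o(1)], and that
   [y(r)] is outside a copy of ratio [1 - o(1)] when [n] is not close to [e].
   Hence the cap has area at most [(1 + o(1)) |B_t|], and the part where [n] is
   far from [e] has area [o(|B_t|)]; conversely the projection along [e] shows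
   that the cap has area at least [|B_t|]. Points with two normals form a null
   set because they lie in countably many Lipschitz images of subsets of
   [R^(d-2)]. *)
Require Import Defs.
From HB Require Import structures.
From mathcomp Require Import all_boot all_order all_algebra finmap.
From mathcomp Require Import all_classical all_reals all_analysis.
From mathcomp Require Import measurable_realfun.
From mathcomp Require Import ring lra zify.

Set Implicit Arguments.
Unset Strict Implicit.
Unset Printing Implicit Defensive.

Import Order.TTheory GRing.Theory Num.Theory.
Import numFieldNormedType.Exports.

Local Open Scope classical_set_scope.
Local Open Scope ring_scope.

(** * Euclidean geometry of row vectors *)

(** No area is ever computed. Sets are compared through maps that do not decrease distances, which
    bound the outer measure [hausdorff_measure] of arbitrary sets, and through the scaling law for
    homotheties. Of [|B_t|] itself only [0 < |B_t| < +oo] enters, and grid arguments give that.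
    Measurability matters at two places: to subtract the measure of a slightly shrunk copy of [B_t]
    from that of a slightly enlarged one, and to make [nu_t] a measure, so that integrals against it
    can be estimated. The first needs closed sets to be Carathéodory measurable. The second needs in
    addition that the points having a normal in a given compact set form a closed set, and that
    points with two normals are negligible. *)

Section euclid.
Context {R : realType} {d : nat}.
Implicit Types (u v w x y : 'rV[R]_d) (a : R).

Lemma dotpE u v : dotp u v = \sum_i u 0 i * v 0 i.
Proof. by rewrite /dotp mxE; apply: eq_bigr => i _; rewrite mxE. Qed.

Lemma dotpC u v : dotp u v = dotp v u.
Proof. by rewrite !dotpE; apply: eq_bigr => i _; rewrite mulrC. Qed.

Lemma dotpDl u v w : dotp (u + v) w = dotp u w + dotp v w.
Proof. by rewrite /dotp mulmxDl mxE. Qed.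

Lemma dotpNl u w : dotp (- u) w = - dotp u w.
Proof. by rewrite /dotp mulNmx mxE. Qed.

Lemma dotpZl a u w : dotp (a *: u) w = a * dotp u w.
Proof. by rewrite /dotp -scalemxAl mxE. Qed.

Lemma dotpDr u v w : dotp w (u + v) = dotp w u + dotp w v.
Proof. by rewrite !(dotpC w) dotpDl. Qed.

Lemma dotpNr u w : dotp w (- u) = - dotp w u.
Proof. by rewrite !(dotpC w) dotpNl. Qed.

Lemma dotpZr a u w : dotp w (a *: u) = a * dotp w u.
Proof. by rewrite !(dotpC w) dotpZl. Qed.

Definition dotp_lin := (dotpDl, dotpNl, dotpZl, dotpDr, dotpNr, dotpZr).

Lemma dotp_ge0 u : 0 <= dotp u u.
Proof. by rewrite dotpE; apply: sumr_ge0 => i _; rewrite -expr2 sqr_ge0. Qed.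

Lemma dotp_eq0 u : (dotp u u == 0) = (u == 0).
Proof.
apply/idP/eqP => [|->]; last by rewrite /dotp mul0mx mxE.
rewrite dotpE psumr_eq0 => [/allP u0|i _]; last by rewrite -expr2 sqr_ge0.
apply/rowP => i; have := u0 i (mem_index_enum _).
by rewrite /= -expr2 sqrf_eq0 mxE => /eqP.
Qed.

Lemma dotp0l u : dotp 0 u = 0.
Proof. by rewrite /dotp mul0mx mxE. Qed.

Lemma enorm_ge0 u : 0 <= enorm u.
Proof. exact: sqrtr_ge0. Qed.

Lemma sqr_enorm u : enorm u ^+ 2 = dotp u u.
Proof. by rewrite sqr_sqrtr // dotp_ge0. Qed.

Lemma enorm1 u : enorm u = 1 <-> dotp u u = 1.
Proof.
rewrite -sqr_enorm; split=> [->|/eqP]; first by rewrite expr1n.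
by rewrite sqrp_eq1 ?enorm_ge0// => /eqP.
Qed.

Lemma ler_enorm u a : 0 <= a -> (enorm u <= a) = (dotp u u <= a ^+ 2).
Proof. by move=> a0; rewrite -sqr_enorm ler_sqr ?nnegrE ?enorm_ge0. Qed.

Lemma le_enorm u v : (enorm u <= enorm v) = (dotp u u <= dotp v v).
Proof. by rewrite ler_enorm ?enorm_ge0// sqr_enorm. Qed.

Lemma enorm0 : enorm (0 : 'rV[R]_d) = 0.
Proof. by rewrite /enorm dotp0l sqrtr0. Qed.

Lemma enormZ a u : enorm (a *: u) = `|a| * enorm u.
Proof. by rewrite /enorm !dotp_lin mulrA -expr2 sqrtrM ?sqr_ge0// sqrtr_sqr.
Qed.

Lemma enormN u : enorm (- u) = enorm u.
Proof. by rewrite /enorm !dotp_lin opprK. Qed.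

Lemma enorm_eq0 u : (enorm u == 0) = (u == 0).
Proof. by rewrite -dotp_eq0 -sqr_enorm sqrf_eq0. Qed.

Lemma cauchy_schwarz u v : dotp u v ^+ 2 <= dotp u u * dotp v v.
Proof.
have [v0|v0] := eqVneq v 0; first by rewrite v0 dotpC !dotp0l expr0n mulr0.
have vv : 0 < dotp v v by rewrite lt_def dotp_eq0 v0 dotp_ge0.
have := dotp_ge0 (dotp v v *: u - dotp u v *: v).
rewrite !dotp_lin (dotpC v u) => h.
rewrite -subr_ge0 -(pmulr_rge0 _ vv); apply: le_trans h _.
by rewrite le_eqVlt; apply/orP; left; apply/eqP; ring.
Qed.

Lemma dotp_le u v : dotp u v <= enorm u * enorm v.
Proof.
apply: le_trans (ler_norm _) _.
rewrite -(@ler_pXn2r _ 2)// ?nnegrE ?mulr_ge0 ?enorm_ge0//.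
by rewrite exprMn !sqr_enorm real_normK ?num_real// cauchy_schwarz.
Qed.

Lemma enormD u v : enorm (u + v) <= enorm u + enorm v.
Proof.
rewrite ler_enorm ?addr_ge0 ?enorm_ge0// !dotp_lin (dotpC v u).
by have := dotp_le u v; rewrite -!sqr_enorm sqrrD; lra.
Qed.

Lemma coord_le_norm u i : `|u 0 i| <= `|u|.
Proof.
by rewrite [leRHS]/Num.Def.normr/= mx_normrE; apply/bigmax_geP; right => /=;
  exists (0, i).
Qed.

Lemma norm_le_coord u a : 0 <= a -> (forall i, `|u 0 i| <= a) -> `|u| <= a.
Proof.
by move=> a0 ua; rewrite [leLHS]/Num.Def.normr/= mx_normrE; apply/bigmax_leP;
  split => // -[i j] _; rewrite ord1.
Qed.

Lemma coord_le_enorm u i : `|u 0 i| <= enorm u.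
Proof.
rewrite -(@ler_pXn2r _ 2)// ?nnegrE ?enorm_ge0// sqr_enorm dotpE.
rewrite real_normK ?num_real// (bigD1 i)//= -expr2 lerDl.
by apply: sumr_ge0 => j _; rewrite -expr2 sqr_ge0.
Qed.

Lemma norm_le_enorm u : `|u| <= enorm u.
Proof. by apply: norm_le_coord; [exact: enorm_ge0|exact: coord_le_enorm]. Qed.

Lemma enorm_le_norm u : enorm u <= d%:R * `|u|.
Proof.
rewrite ler_enorm ?mulr_ge0// dotpE.
apply: (@le_trans _ _ (\sum_(i < d) `|u| ^+ 2)).
  apply: ler_sum => i _; rewrite -expr2 -real_normK ?num_real//.
  by rewrite ler_pXn2r ?nnegrE// coord_le_norm.
rewrite sumr_const card_ord exprMn -[leLHS]mulr_natl ler_wpM2r ?sqr_ge0//.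
by rewrite -natrX ler_nat; case: (d) => // n;
  rewrite -{1}(expn1 n.+1) leq_pexp2l.
Qed.

Lemma enorm_le_coord u a : 0 <= a -> (forall i, `|u 0 i| <= a) ->
  enorm u <= d%:R * a.
Proof.
move=> a0 ua; rewrite (le_trans (enorm_le_norm _))// ler_wpM2l//.
exact: norm_le_coord.
Qed.

Lemma continuous_dotp (T : topologicalType) (f g : T -> 'rV[R]_d) :
  continuous f -> continuous g -> continuous (fun z => dotp (f z) (g z)).
Proof.
move=> cf cg; rewrite (_ : (fun z => _) = fun z => \sum_i f z 0 i * g z 0 i).
  apply: continuous_big => [|i _ z]; first exact: add_continuous.
  apply: cvgM.
    exact: (continuous_cvg _ (@coord_continuous _ _ _ 0 i (f z)) (cf z)).
  exact: (continuous_cvg _ (@coord_continuous _ _ _ 0 i (g z)) (cg z)).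
by apply/funext => w; rewrite dotpE.
Qed.

Lemma continuous_dotpl (r v : 'rV[R]_d) : continuous (fun x => dotp (x - r) v).
Proof.
apply: (@continuous_dotp _ (fun x : 'rV[R]_d => x - r) (cst v));
  last exact: cst_continuous.
by move=> z; exact: cvgB cvg_id (cvg_cst r).
Qed.

Lemma continuous_enorm : continuous (@enorm R d).
Proof.
have c := @continuous_dotp 'rV[R]_d id id (fun z => cvg_id) (fun z => cvg_id).
by move=> z; exact: (continuous_comp (c z) (@sqrt_continuous R _)).
Qed.

Lemma closed_halfspace_ge (r v : 'rV[R]_d) a : closed [set x | a <= dotp (x -
  r) v].
Proof.
apply: (@preimage_closed _ _ (fun x => dotp (x - r) v) [set t | a <= t]).
  by move=> x _; exact: continuous_dotpl.
exact: closed_ge.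
Qed.

Lemma closed_hyperplane (r v : 'rV[R]_d) a : closed [set x | dotp (x - r) v =
  a].
Proof.
apply: (@preimage_closed _ _ (fun x => dotp (x - r) v) [set t | t = a]).
  by move=> x _; exact: continuous_dotpl.
exact: closed_eq.
Qed.

Lemma compact_usphere : compact (@usphere R d).
Proof.
apply: bounded_closed_compact.
  exists 1; split => // x x1 u /= u1.
  by rewrite (le_trans (norm_le_enorm _))// u1 ltW.
apply: (@preimage_closed _ _ (@enorm R d) [set t | t = 1]).
  by move=> x _; exact: continuous_enorm.
exact: closed_eq.
Qed.

Lemma convex_setP (C : set 'rV[R]_d) : convex_set C ->
  forall x y a, 0 <= a <= 1 -> C x -> C y -> C (a *: x + (1 - a) *: y).
Proof.
move=> cC x y a /andP[a0 a1] Cx Cy.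
have := cC x y (Itv01 a0 a1); rewrite !inE => /(_ Cx Cy).
by [].
Qed.

End euclid.

(** * Hausdorff measures *)

Lemma unit_ball_volume_gt0 (R : realType) m : 0 < unit_ball_volume R m.
Proof.
suff : 0 < unit_ball_volume R m /\ 0 < unit_ball_volume R m.+1 by case.
elim: m => [|m [h0 h1]]; first by split => /=.
by split => //=; rewrite mulr_gt0// divr_gt0// mulr_gt0// pi_gt0.
Qed.

Section hausdorff.
Context {R : realType} {d : nat}.
Implicit Types (A B F : set 'rV[R]_d) (m : nat) (delta : R).
Local Open Scope ereal_scope.

Definition hausdorff_const m : R := (unit_ball_volume R m / 2 ^+ m)%R.

Lemma hausdorff_const_gt0 m : (0 < hausdorff_const m)%R.
Proof. by rewrite divr_gt0 ?unit_ball_volume_gt0// exprn_gt0. Qed.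

Lemma ediam_ge A x y : A x -> A y -> (enorm (x - y))%:E <= ediam A.
Proof. by move=> Ax Ay; apply: ereal_sup_ubound; exists (x, y). Qed.

Lemma ediam_le A (a : R) : (forall x y, A x -> A y -> (enorm (x - y) <= a)%R) ->
  ediam A <= a%:E.
Proof.
by move=> h; apply: ge_ereal_sup => _ [[x y] [/= Ax Ay] <-]; rewrite lee_fin h.
Qed.

Lemma ediam_leP A (a : R) x y : ediam A <= a%:E -> A x -> A y ->
  (enorm (x - y) <= a)%R.
Proof. by move=> h Ax Ay; rewrite -lee_fin (le_trans (ediam_ge Ax Ay)). Qed.

Lemma ediam_set0 : ediam (set0 : set 'rV[R]_d) = -oo.
Proof. by rewrite /ediam setX0 image_set0 ereal_sup0. Qed.

Lemma le_ediam A B : A `<=` B -> ediam A <= ediam B.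
Proof.
by move=> AB; apply: ereal_sup_le => _ [[x y] [/= Ax Ay] <-];
  exists (x, y) => //; split; exact: AB.
Qed.

Lemma ediam_ge0 A : A !=set0 -> 0 <= ediam A.
Proof.
by move=> [x Ax]; apply: le_trans (ediam_ge Ax Ax); rewrite lee_fin enorm_ge0.
Qed.

Lemma hausdorff_gauge0 m : hausdorff_gauge m (set0 : set 'rV[R]_d) = 0.
Proof. by rewrite /hausdorff_gauge eqxx. Qed.

Lemma hausdorff_gaugeE m A delta : A !=set0 -> ediam A <= delta%:E ->
  exists a : R, [/\ (0 <= a <= delta)%R, ediam A = a%:E &
    hausdorff_gauge m A = (hausdorff_const m * a ^+ m)%:E].
Proof.
move=> A0 Ad; have := ediam_ge0 A0; move: Ad.
case E : (ediam A) => [a| |]//; rewrite !lee_fin => ad a0.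
exists a; split => //; first by rewrite a0 ad.
by move/set0P/negbTE : A0 => A0;
  rewrite /hausdorff_gauge A0 E [RHS]EFinM EFin_expe.
Qed.

Lemma hausdorff_gauge_ge0 m A : 0 <= hausdorff_gauge m A.
Proof.
rewrite /hausdorff_gauge; case: ifPn => // /set0P A0.
by rewrite mule_ge0 ?expe_ge0 ?ediam_ge0// lee_fin ltW// hausdorff_const_gt0.
Qed.

Lemma hausdorff_gauge_le m A (a : R) : (0 <= a)%R -> ediam A <= a%:E ->
  hausdorff_gauge m A <= (hausdorff_const m * a ^+ m)%:E.
Proof.
move=> a0 Aa; have [->|/set0P A0] := eqVneq A set0.
  by rewrite hausdorff_gauge0 lee_fin mulr_ge0 ?exprn_ge0// ltW//
    hausdorff_const_gt0.
have [b [/andP[b0 ba] _ ->]] := hausdorff_gaugeE m A0 Aa.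
by rewrite lee_fin ler_wpM2l ?lerXn2r// ltW// hausdorff_const_gt0.
Qed.

(** The condition on [g] says that its inverse is [L]-Lipschitz. In this form a cover of the target
    pulls back to a cover of the source with diameters multiplied by at most [L], and [g] may come
    from arbitrary choices, as normals and lifted points do below. *)
Lemma hausdorff_gauge_lip m A B delta (g : 'rV[R]_d -> 'rV[R]_d) (L : R) :
  (0 <= L)%R -> ediam B <= delta%:E -> (forall x, A x -> B (g x)) ->
  (forall x y, A x -> A y -> (enorm (x - y) <= L * enorm (g x - g y))%R) ->
  (ediam A <= (L * delta)%:E) /\
  (hausdorff_gauge m A <= (L ^+ m)%:E * hausdorff_gauge m B).
Proof.
move=> L0 Bd AB lip.
have [->|/set0P A0] := eqVneq A set0.
  rewrite hausdorff_gauge0 ediam_set0 leNye; split => //.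
  by rewrite mule_ge0 ?hausdorff_gauge_ge0// lee_fin exprn_ge0.
have B0 : B !=set0 by case: A0 => x /AB; exists (g x).
have [b [/andP[b0 bd] Eb ->]] := hausdorff_gaugeE m B0 Bd.
have Ab : ediam A <= (L * b)%:E.
  apply: ediam_le => x y Ax Ay; apply: le_trans (lip _ _ Ax Ay) _.
  by rewrite ler_wpM2l// -lee_fin -Eb; apply: ediam_ge; exact: AB.
split; first by apply: le_trans Ab _; rewrite lee_fin ler_wpM2l.
apply: le_trans (hausdorff_gauge_le m _ Ab) _; first by rewrite mulr_ge0.
by rewrite lee_fin exprMn mulrCA.
Qed.

Lemma le_hausdorff_gauge m A B delta : ediam B <= delta%:E -> A `<=` B ->
  hausdorff_gauge m A <= hausdorff_gauge m B.
Proof.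
move=> Bd AB; have [|_] := @hausdorff_gauge_lip m A B delta id 1 ler01 Bd AB.
- by move=> x y _ _; rewrite mul1r.
- by rewrite expr1n mul1e.
Qed.

Definition small_gauge m delta A : \bar R :=
  if ediam A <= delta%:E then hausdorff_gauge m A else +oo.

Lemma small_gauge0 m delta : small_gauge m delta set0 = 0.
Proof. by rewrite /small_gauge ediam_set0 leNye hausdorff_gauge0. Qed.

Lemma small_gauge_ge0 m delta A : 0 <= small_gauge m delta A.
Proof. by rewrite /small_gauge; case: ifP => // _; exact: hausdorff_gauge_ge0.
Qed.

(* The library builds outer measures from a semiring of sets: every set is made
   admissible, and sets of large diameter are penalized in [small_gauge]. *)
Local Notation all_sets := (g_sigma_algebraType (@setT (set 'rV[R]_d))).

Lemma hausdorff_contentE m delta A :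
  hausdorff_content m delta A =
  mu_ext (small_gauge m delta : set all_sets -> _) A.
Proof.
apply/eqP; rewrite eq_le; apply/andP; split.
  apply: le_ereal_inf_tmp => _ [F [_ AF] <-].
  have [h|] := pselect (forall i, ediam (F i) <= delta%:E).
    apply: ereal_inf_lbound; exists F; first by split.
    by apply: eq_eseriesr => i _; rewrite /small_gauge h.
  move=> /existsNP[i hi]; rewrite (eseries_pinfty _ (isT : xpredT i)) ?leey//.
    by move=> n _; rewrite -ltNye (lt_le_trans _ (small_gauge_ge0 _ _ _)).
  by rewrite /small_gauge ifF//; apply/negbTE/negP.
apply: le_ereal_inf_tmp => _ [F [AF h] <-].
apply: ereal_inf_lbound; exists F.
  by split => // i; apply: sub_sigma_algebra.
by apply: eq_eseriesr => i _; rewrite /small_gauge h.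
Qed.

Lemma hausdorff_content_ge0 m delta A : 0 <= hausdorff_content m delta A.
Proof.
by rewrite hausdorff_contentE mu_ext_ge0// => B; exact: small_gauge_ge0.
Qed.

Lemma hausdorff_content_subadd m delta :
  sigma_subadditive (hausdorff_content m delta : set 'rV[R]_d -> _).
Proof.
move=> F; rewrite hausdorff_contentE.
under eq_eseriesr do rewrite hausdorff_contentE.
by apply: (@mu_ext_sigma_subadditive _ all_sets) => B; exact: small_gauge_ge0.
Qed.

Lemma hausdorff_content_le_cover m delta A (F : nat -> set 'rV[R]_d) :
  A `<=` \bigcup_i F i -> (forall i, ediam (F i) <= delta%:E) ->
  hausdorff_content m delta A <= \sum_(0 <= i <oo) hausdorff_gauge m (F i).
Proof. by move=> AF Fd; apply: ereal_inf_lbound; exists F. Qed.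

Lemma hausdorff_content_lip m A B delta (g : 'rV[R]_d -> 'rV[R]_d) (L : R) :
  (0 < L)%R -> (forall x, A x -> B (g x)) ->
  (forall x y, A x -> A y -> (enorm (x - y) <= L * enorm (g x - g y))%R) ->
  hausdorff_content m (L * delta) A <= (L ^+ m)%:E *
    hausdorff_content m delta B.
Proof.
move=> L0 AB lip; have Lm0 : (0 < L ^+ m)%R by rewrite exprn_gt0.
rewrite -lee_pdivrMl//; apply: le_ereal_inf_tmp => _ [F [BF Fd] <-].
rewrite lee_pdivrMl// -nneseriesZl; last first.
  by move=> i _; exact: hausdorff_gauge_ge0.
pose G i := A `&` (g @^-1` F i).
have GF i : ediam (G i) <= (L * delta)%:E /\
    hausdorff_gauge m (G i) <= (L ^+ m)%:E * hausdorff_gauge m (F i).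
  apply: (@hausdorff_gauge_lip _ _ _ _ g) (Fd i) _ _; first exact: ltW.
    by move=> x [].
  by move=> x y [Ax _] [Ay _]; exact: lip.

apply: (@le_trans _ _ (\sum_(0 <= i <oo) hausdorff_gauge m (G i))).
  apply: hausdorff_content_le_cover => [x Ax|i]; last by have [] := GF i.
  by have [i _ Fi] := BF _ (AB _ Ax); exists i.
apply: lee_nneseries => [i _ _|i _]; last by have [] := GF i.
exact: hausdorff_gauge_ge0.
Qed.

Lemma hausdorff_content_le_measure m A delta : (0 < delta)%R ->
  hausdorff_content m delta A <= hausdorff_measure m A.
Proof. by move=> d0; apply: ereal_sup_ubound; exists delta. Qed.

Lemma hausdorff_measure_lip m A B (g : 'rV[R]_d -> 'rV[R]_d) (L : R) :
  (0 < L)%R -> (forall x, A x -> B (g x)) ->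
  (forall x y, A x -> A y -> (enorm (x - y) <= L * enorm (g x - g y))%R) ->
  hausdorff_measure m A <= (L ^+ m)%:E * hausdorff_measure m B.
Proof.
move=> L0 AB lip; apply: ge_ereal_sup => _ [delta /= d0 <-].
rewrite -(mulfVK (lt0r_neq0 L0) delta) mulrC.
apply: le_trans (hausdorff_content_lip _ _ L0 AB lip) _.
apply: lee_wpmul2l; first by rewrite lee_fin exprn_ge0// ltW.
by apply: hausdorff_content_le_measure; rewrite divr_gt0.
Qed.

Lemma hausdorff_measure_ge0 m A : 0 <= hausdorff_measure m A.
Proof.
apply: le_trans (hausdorff_content_le_measure m A ltr01).
exact: hausdorff_content_ge0.
Qed.

Lemma hausdorff_measure_expansive m A B (g : 'rV[R]_d -> 'rV[R]_d) :
  (forall x, A x -> B (g x)) ->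
  (forall x y, A x -> A y -> (enorm (x - y) <= enorm (g x - g y))%R) ->
  hausdorff_measure m A <= hausdorff_measure m B.
Proof.
move=> AB lip; have := @hausdorff_measure_lip m A B g 1 ltr01 AB.
by rewrite expr1n mul1e; apply => x y Ax Ay; rewrite mul1r lip.
Qed.

Lemma le_hausdorff_measure m : {homo @hausdorff_measure R d m : A B / A `<=` B
  >-> A <= B}.
Proof. by move=> A B AB; apply: (@hausdorff_measure_expansive _ _ _ id). Qed.

Lemma hausdorff_measure0 m : hausdorff_measure m (set0 : set 'rV[R]_d) = 0.
Proof.
apply/eqP; rewrite eq_le hausdorff_measure_ge0 andbT.
apply: ge_ereal_sup => _ [delta /= d0 <-].
rewrite hausdorff_contentE mu_ext0//.
  exact: small_gauge0.
exact: small_gauge_ge0.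
Qed.

Lemma hausdorff_measure_subadd m :
  sigma_subadditive (@hausdorff_measure R d m).
Proof.
move=> F; apply: ge_ereal_sup => _ [delta /= d0 <-].
apply: le_trans (hausdorff_content_subadd _ _ _) _.
apply: lee_nneseries => [i _ _|i _]; first exact: hausdorff_content_ge0.
exact: hausdorff_content_le_measure.
Qed.

End hausdorff.

HB.instance Definition _ (R : realType) (d m : nat) :=
  isOuterMeasure.Build R 'rV[R]_d (@hausdorff_measure R d m)
    (hausdorff_measure0 m) (hausdorff_measure_ge0 m)
    (@le_hausdorff_measure R d m) (@hausdorff_measure_subadd R d m).

(** * Carathéodory measurability of closed sets and null sets *)

Section metric_outer_measure.
Context {R : realType} {d : nat}.
Implicit Types (A B F X : set 'rV[R]_d) (m : nat) (delta : R).
Local Open Scope ereal_scope.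

Lemma sum_even_odd (u : nat -> \bar R) n :
  \sum_(0 <= k < n.*2) u k =
  \sum_(k < n) u (k.*2 + 0)%N + \sum_(k < n) u (k.*2 + 1)%N.
Proof.
elim: n => [|n IHn]; first by rewrite double0 big_geq// !big_ord0 adde0.
rewrite doubleS !big_nat_recr//= !big_ord_recr/= IHn addn0 addn1.
by rewrite -!addeA; congr (_ + _); rewrite addeCA.
Qed.

(** Extracts one supremum from a sum, so that [hausdorff_measure_sep] can handle the scales of its
    two sets one after the other. When [b] is [+oo], any element of [S] forces [c] to be [+oo]. *)
Lemma ereal_supD_le (S : set \bar R) (b c : \bar R) :
  S !=set0 -> (forall x, S x -> 0 <= x) -> 0 <= b ->
  (forall x, S x -> x + b <= c) -> ereal_sup S + b <= c.
Proof.
case: b => [b| |]//.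
- move=> S0 Sge0 b0 Sb; rewrite -leeBrDr//; apply: ge_ereal_sup => x Sx.
  by rewrite leeBrDr//; exact: Sb.
- move=> [x Sx] Sge0 _ /(_ _ Sx).
  by rewrite addey ?leye_eq => [/eqP ->|];
    rewrite ?leey// -ltNye (lt_le_trans _ (Sge0 _ Sx)).
Qed.

Lemma le_hausdorff_content m A delta1 delta2 : (delta1 <= delta2)%R ->
  hausdorff_content m delta2 A <= hausdorff_content m delta1 A.
Proof.
move=> d12; apply: ereal_inf_le_tmp => _ [F [AF Fd] <-]; exists F => //.
by split => // i; rewrite (le_trans (Fd i))// lee_fin.
Qed.

(** A set of diameter at most [delta < delta0] cannot meet both [A] and [B], so each member of a
    cover is charged to at most one of them. *)
Lemma hausdorff_content_sep m A B delta delta0 : (delta < delta0)%R ->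
  (forall x y, A x -> B y -> (delta0 <= enorm (x - y))%R) ->
  hausdorff_content m delta A + hausdorff_content m delta B <=
  hausdorff_content m delta (A `|` B).
Proof.
move=> dd0 sep; apply: le_ereal_inf_tmp => _ [F [ABF Fd] <-].
have cover X : X `<=` A `|` B -> hausdorff_content m delta X <=
    \sum_(0 <= i <oo) hausdorff_gauge m (F i `&` X).
  move=> XAB; apply: hausdorff_content_le_cover => [x Xx|i].
    by have [i _ Fix] := ABF _ (XAB _ Xx); exists i.
  by apply: le_trans (Fd i); apply: le_ediam; exact: subIsetl.
apply: le_trans (leeD (cover A _) (cover B _)) _.
- exact: subsetUl.
- exact: subsetUr.
have g0 X i : xpredT i -> 0 <= hausdorff_gauge m (F i `&` X).
  by move=> _; exact: hausdorff_gauge_ge0.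
rewrite -nneseriesD; [|by move=> i _; exact: g0|by move=> i _; exact: g0].
apply: lee_nneseries => [i _ _|i _]; first by rewrite adde_ge0// g0.
have gle X : hausdorff_gauge m (F i `&` X) <= hausdorff_gauge m (F i).
  by apply: (le_hausdorff_gauge m (Fd i)); exact: subIsetl.
have [->|/set0P[x [Fx Ax]]] := eqVneq (F i `&` A) set0.
  by rewrite hausdorff_gauge0 add0e.
rewrite (_ : F i `&` B = set0) ?hausdorff_gauge0 ?adde0//.
rewrite -subset0 => y [Fy By].
have := ediam_leP (Fd i) Fx Fy.
by rewrite leNgt (lt_le_trans dd0)// sep.
Qed.

Lemma hausdorff_measure_sep m A B delta0 : (0 < delta0)%R ->
  (forall x y, A x -> B y -> (delta0 <= enorm (x - y))%R) ->
  hausdorff_measure m A + hausdorff_measure m B <=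
  hausdorff_measure m (A `|` B).
Proof.
move=> d00 sep.
apply: ereal_supD_le => [|_ [delta _ <-]||_ [d1 /= d10 <-]].
- by exists (hausdorff_content m 1 A); exists 1%R => //=.
- exact: hausdorff_content_ge0.
- exact: hausdorff_measure_ge0.
rewrite addeC; apply: ereal_supD_le => [|_ [delta _ <-]||_ [d2 /= d20 <-]].
- by exists (hausdorff_content m 1 B); exists 1%R => //=.
- exact: hausdorff_content_ge0.
- exact: hausdorff_content_ge0.
(* Contents grow as the scale shrinks, so one scale below [d1], [d2] and [delta0] serves both
   sets. *)
pose delta := Num.min (Num.min d1 d2) (delta0 / 2)%R.
have dpos : (0 < delta)%R by rewrite !lt_min d10 d20 divr_gt0.
have dd0 : (delta < delta0)%R.
  apply: (@le_lt_trans _ _ (delta0 / 2)%R); first by rewrite ge_min lexx orbT.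
  by rewrite ltr_pdivrMr// ltr_pMr// ltr1n.
apply: le_trans (hausdorff_content_le_measure m _ dpos).
apply: le_trans (hausdorff_content_sep m dd0 sep); rewrite addeC.
by apply: leeD; apply: le_hausdorff_content; rewrite !ge_min lexx ?orbT.
Qed.

(* The classical argument for metric outer measures: the shells
   [D n.+2 `\` D n.+1] of equal parity are at positive distance from each
   other, so their measures form a convergent series. *)
Lemma closed_caratheodory m F :
  closed F -> (@hausdorff_measure R d m).-caratheodory F.
Proof.
move=> cF; apply: le_caratheodory_measurable => X.
pose H := @hausdorff_measure R d m.
change (H (X `&` F) + H (X `&` ~` F) <= H X).
have [->|HXoo] := eqVneq (H X) +oo; first by rewrite leey.
have HXfin : H X \is a fin_num.
  by rewrite ge0_fin_numE ?hausdorff_measure_ge0// ltey.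
pose D n : set 'rV[R]_d := [set x | forall y, F y ->
  (n.+1%:R^-1 <= `|x - y|)%R].
have leD i j : (i <= j)%N -> D i `<=` D j.
  move=> ij x Dx y Fy; apply: le_trans (Dx _ Fy).
  by rewrite lef_pV2 ?posrE// ler_nat ltnS.
have sepD n x y : D n x -> ~ D n.+1 y ->
    (n.+1%:R^-1 - n.+2%:R^-1 <= enorm (x - y))%R.
  move=> Dx /existsNP[z /not_implyP[Fz /negP]]; rewrite -ltNge => yz.
  apply: le_trans (norm_le_enorm _).
  rewrite lerBlDr; apply: le_trans (Dx _ Fz) _.
  by apply: le_trans (ler_distD y _ _) _; rewrite lerD2l ltW.
have gap_gt0 n : (0 < n.+1%:R^-1 - n.+2%:R^-1 :> R)%R.
  by rewrite subr_gt0 ltf_pV2 ?posrE// ltr_nat.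
have notF : ~` F `<=` \bigcup_n D n.
  move=> x nFx; have : open (~` F) by exact: closed_openC.
  move=> /(_ x nFx)/nbhs_ballP[e /= e0 ball_e].
  have [n _ /(_ n (leqnn n)) ne] := near_infty_natSinv_lt (PosNum e0).
  exists n => // y Fy; rewrite leNgt; apply/negP => xy.
  apply: (ball_e y _ Fy); rewrite -ball_normE /=.
  exact: lt_trans xy ne.
pose shell k := X `&` (D k.+2 `\` D k.+1).
have shell_sum b n : \sum_(k < n) H (shell (k.*2 +
  b)%N) <= H (X `&` D (n.*2 + b)%N).
  elim: n => [|n IHn]; first by rewrite big_ord0 hausdorff_measure_ge0.
  rewrite big_ord_recr /=; apply: le_trans (leeD IHn (lexx _)) _.
  apply: le_trans (hausdorff_measure_sep m (gap_gt0 (n.*2 + b)%N) _) _.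
    by move=> x y [_ Dx] [_ [_ Dy]]; exact: sepD.
  apply: le_hausdorff_measure => x [[Xx Dx]|[Xx [Dx _]]]; split => //.
  by apply: leD Dx; rewrite leq_add2r leq_double.
have shell_sumX n : \sum_(0 <= k < n) H (shell k) <= H X + H X.
  apply: (@le_trans _ _ (\sum_(0 <= k < n.*2) H (shell k))).
    apply: lee_sum_nneg_natr => [k _ _|]; first exact: hausdorff_measure_ge0.
    by rewrite -addnn leq_addr.
  rewrite (_ : \sum_(_ <= k < _) _ = \sum_(k < n) H (shell (k.*2 + 0)%N) +
      \sum_(k < n) H (shell (k.*2 + 1)%N)).
    apply: leeD; apply: le_trans (shell_sum _ _) _;
    by apply: le_hausdorff_measure; exact: subIsetl.
  exact: (sum_even_odd (H \o shell)).
have tail0 : \sum_(N <= k <oo) H (shell k) @[N --> \oo] --> 0.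
  apply: nneseries_tail_cvg => [|k _]; last exact: hausdorff_measure_ge0.
  apply: (@le_lt_trans _ _ (H X + H X)).
    apply: lime_le; last by apply: nearW => n; exact: shell_sumX.
    by apply: is_cvg_nneseries => k _ _; exact: hausdorff_measure_ge0.
  by rewrite -ge0_fin_numE ?adde_ge0 ?hausdorff_measure_ge0// fin_numD HXfin.
have key N : H (X `&` F) + H (X `&` ~` F) <=
    H X + \sum_(N <= k <oo) H (shell k).
  have cover : X `&` ~` F `<=` (X `&` D N.+1) `|` \bigcup_(k in ~` `I_N) shell
    k.
    move=> x [Xx /notF Dx]; have [j _ Dj] := Dx.
    have [|DN] := pselect (D N.+1 x); first by left.
    right; have Ej : exists n, `[< D n x >] by exists j; apply/asboolP.
    (* The least index whose [D] contains [x] exceeds [N.+1], since the [D n] increase; hence it is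
       some [k.+2] with [N <= k], and [x] lies in [shell k]. *)
    case: (ex_minnP Ej) => -[|[|k]] /asboolP Dk mink.
    - by case: DN; apply: leD Dk.
    - by case: DN; apply: leD Dk.
    exists k; last first.
      by split => //; split => // /asboolP/mink; rewrite ltnn.
    by move=> /= kN; apply: DN; apply: leD Dk; rewrite ltnS.
  have := le_hausdorff_measure m cover.
  move/le_trans => /(_ _ (outer_measureU2 (@hausdorff_measure R d m) _ _)) h.
  apply: le_trans (leeD (lexx _) h) _; rewrite addeA; apply: leeD.
    apply: le_trans (hausdorff_measure_sep (delta0 := N.+2%:R^-1) m _ _) _.
    - by rewrite invr_gt0.
    - move=> x y [_ Fx] [_ Dy]; apply: le_trans (Dy _ Fx) _.
      by rewrite distrC norm_le_enorm.
    - by apply: le_hausdorff_measure => x [[]|[]].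
  exact: outer_measure_sigma_subadditive_tail.
rewrite -[leRHS]adde0.
apply: (cvge_to_ge (cvgeD (fin_num_adde_defr 0 HXfin) (cvg_cst (H X)) tail0)).
by apply: nearW => N; exact: key.
Qed.

Lemma null_caratheodory m A : hausdorff_measure m A = 0 ->
  (@hausdorff_measure R d m).-caratheodory A.
Proof.
move=> A0; apply: le_caratheodory_measurable => X.
rewrite -[leRHS]add0e; apply: leeD; last by apply: le_hausdorff_measure;
  exact: subIsetl.
by rewrite -A0; apply: le_hausdorff_measure; exact: subIsetr.
Qed.

End metric_outer_measure.

Lemma leq_exp2r_le (a b n : nat) : (a <= b)%N -> (a ^ n <= b ^ n)%N.
Proof. by case: n => // n ab; rewrite leq_exp2r. Qed.

(** * Upper bounds by covers with grid cells *)

Section upper.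
Context {R : realType} {d : nat}.
Implicit Types (E A : set 'rV[R]_d) (m : nat).

Lemma hausdorff_content_finite_cover m (delta : R) A n (F : nat ->
  set 'rV[R]_d) :
  A `<=` \bigcup_(i in `I_n) F i ->
  (forall i, (i < n)%N -> ediam (F i) <= delta%:E)%E ->
  (hausdorff_content m delta A <= \sum_(i < n) hausdorff_gauge m (F i))%E.
Proof.
move=> AF Fd; pose G i := if (i < n)%N then F i else set0.
apply: (@le_trans _ _ (\sum_(0 <= i <oo) hausdorff_gauge m (G i))%E).
  apply: hausdorff_content_le_cover => [x /AF[i /= ni Fi]|i].
    by exists i => //; rewrite /G ni.
  by rewrite /G; case: ifP => [/Fd//|_]; rewrite ediam_set0 leNye.
rewrite (nneseries_split _ n); last by move=> k _; exact: hausdorff_gauge_ge0.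
rewrite [X in (_ + X)%E]eseries0 ?adde0; last first.
  by move=> k nk _; rewrite /G ltnNge nk/= hausdorff_gauge0.
by rewrite big_mkord; apply: lee_sum => i _; rewrite /G ltn_ord.
Qed.

Lemma truncn_eq_dist (x y : R) : 0 <= x -> 0 <= y ->
  Num.truncn x = Num.truncn y -> `|x - y| <= 1.
Proof.
move=> /truncn_itv/andP[+ +] /truncn_itv/andP[+ +] e; rewrite e -!natr1.
by rewrite ler_norml; lra.
Qed.

(** Index of the cell of width [1 / N.+1] that contains [x], meaningful for [x] in [[-M, M]]; the
    extra last cell receives the end point [M]. *)
Definition round (M N : nat) (x : R) : 'I_(2 * M * N.+1).+1 :=
  inord (Num.truncn ((x + M%:R) * N.+1%:R)).

Lemma round_eq (M N : nat) (x y : R) : `|x| <= M%:R -> `|y| <= M%:R ->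
  round M N x = round M N y -> `|x - y| <= N.+1%:R^-1.
Proof.
have bd (z : R) : `|z| <= M%:R -> 0 <= (z + M%:R) * N.+1%:R /\
    (Num.truncn ((z + M%:R) * N.+1%:R) < (2 * M * N.+1).+1)%N.
  rewrite ler_norml => /andP[z0 z1].
  have z2 : 0 <= (z + M%:R) * N.+1%:R by rewrite mulr_ge0// -lerBlDr sub0r.
  split => //; rewrite ltnS -(ler_nat R);
    apply: (@le_trans _ _ ((z + M%:R) * N.+1%:R)); first by rewrite truncn_le.
  by rewrite natrM ler_wpM2r// natrM mulr_natl mulr2n lerD2r.
move=> /bd[x0 xb] /bd[y0 yb] /(congr1 val) /=; rewrite !inordK// => e.
have h := truncn_eq_dist x0 y0 e.
have -> : x - y = ((x + M%:R) * N.+1%:R - (y + M%:R) * N.+1%:R) * N.+1%:R^-1.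
  by rewrite -mulrBl mulfK// ?pnatr_eq0//; ring.
by rewrite normrM [X in _ * X]gtr0_norm ?invr_gt0// ler_piMl// invr_ge0.
Qed.

Section covering.
Variables (X : finType) (key : 'rV[R]_d -> X) (J : {set 'I_d}).
Variables (E : set 'rV[R]_d) (M : nat) (L : R) (m : nat).
Hypothesis L0 : 0 <= L.
Hypothesis EM : forall x i, E x -> `|x 0 i| <= M%:R.
(** On each fibre of [key] the coordinates in [J] control the distance, so the fibre is a Lipschitz
    graph over a set of dimension [#|J|]. Cutting by [key] and by cells in these coordinates gives
    about [N ^ #|J|] pieces of diameter at most [L / N]: finite measure if [#|J| <= m], measure zero
    if [#|J| < m]. *)
Hypothesis keyP : forall x y tau, 0 <= tau -> E x -> E y -> key x = key y ->
  (forall l, l \in J -> `|x 0 l - y 0 l| <= tau) -> enorm (x - y) <= L * tau.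

Let b N := (2 * M * N.+1).+1.
(** Since [b N <= (2 * M).+1 * N.+1], this constant absorbs everything except the power of [N.+1]
    with exponent [m - #|J|]. *)
Let K : R := (#|X| * (2 * M).+1 ^ #|J|)%:R * (hausdorff_const m * L ^+ m).

Let hausdorff_content_cover (N : nat) :
  (hausdorff_content m (L / N.+1%:R) E <=
   ((#|X| * b N ^ #|J|)%:R * (hausdorff_const m * (L / N.+1%:R) ^+ m))%:E)%E.
Proof.
pose I := {l : 'I_d | l \in J}.
pose full x : X * {ffun I -> 'I_(b N)} :=
  (key x, [ffun l : I => round M N (x 0 (val l))]).
pose F i : set 'rV[R]_d := E `&` [set x | enum_rank (full x) = i :> nat].
have Fd i : (ediam (F i) <= (L / N.+1%:R)%:E)%E.
  apply: ediam_le => x y [Ex xi] [Ey yi].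
  have : full x = full y by apply/enum_rank_inj/val_inj; rewrite /= xi yi.
  case=> kxy /ffunP fxy; apply: keyP => // l lJ.
  apply: (round_eq (EM _ Ex) (EM _ Ey)).
  by have := fxy (exist _ l lJ); rewrite !ffunE.
have -> : (#|X| * b N ^ #|J|)%N = #|{: X * {ffun I -> 'I_(b N)}}|.
  by rewrite card_prod card_ffun card_ord card_sig; congr (_ * _ ^ _)%N;
    apply: eq_card.
apply: le_trans (hausdorff_content_finite_cover (n := #|{: X * {ffun I ->
  'I_(b N)}}|)
  m (F := F) _ (fun i _ => Fd i)) _.
  by move=> x Ex; exists (enum_rank (full x)) => /=.
rewrite mulr_natl -[X in (_ *+ X)%R]card_ord -sumr_const -sumEFin.
apply: lee_sum => i _; apply: hausdorff_gauge_le (Fd i).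
by rewrite divr_ge0.
Qed.

Let hausdorff_content_cover' (N : nat) : (#|J| <= m)%N ->
  (hausdorff_content m (L / N.+1%:R) E <= (K / N.+1%:R ^+ (m - #|J|))%:E)%E.
Proof.
move=> Jm; apply: le_trans (hausdorff_content_cover N) _; rewrite lee_fin.
have hK : 0 <= hausdorff_const m * L ^+ m.
  by rewrite mulr_ge0 ?exprn_ge0// ltW// hausdorff_const_gt0.
pose u : R := N.+1%:R; have u0 k : 0 < u ^+ k by rewrite exprn_gt0// ltr0n.
have -> : (L / u) ^+ m = L ^+ m / u ^+ (m - #|J|) / u ^+ #|J|.
  by rewrite expr_div_n -[X in _ / _ ^+ X = _](subnK Jm) exprD invfM mulrA.
rewrite [leLHS](_ : _ = (#|X| * b N ^ #|J|)%:R / u ^+ #|J| *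
    (hausdorff_const m * L ^+ m / u ^+ (m - #|J|))); last by rewrite -/u; ring.
rewrite /K -[leRHS]mulrA; apply: ler_wpM2r;
  first by rewrite mulr_ge0// invr_ge0 ltW.
rewrite ler_pdivrMr// -natrX -natrM ler_nat -mulnA leq_mul2l; apply/orP; right.
by rewrite -expnMn; apply: leq_exp2r_le; rewrite /b mulnS; lia.
Qed.

Let small_scale (delta : R) : 0 < delta -> exists N, forall n, (N <= n)%N ->
  L / n.+1%:R <= delta.
Proof.
move=> delta0; exists (Num.truncn (L / delta)) => n Nn.
rewrite ler_pdivrMr// mulrC -ler_pdivrMr//; apply/ltW.
by apply: lt_le_trans (truncnS_gt _) _; rewrite ler_nat ltnS.
Qed.

Lemma hausdorff_measure_lt_pinfty : (#|J| <= m)%N ->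
  (hausdorff_measure m E < +oo)%E.
Proof.
move=> Jm; have K0 : 0 <= K.
  by rewrite !mulr_ge0 ?exprn_ge0// ltW// unit_ball_volume_gt0.
apply: (@le_lt_trans _ _ K%:E); last exact: ltry.
apply: ge_ereal_sup => _ [delta /= delta0 <-].
have [N /(_ N (leqnn N)) LN] := small_scale delta0.
apply: le_trans (le_hausdorff_content m E LN) _.
apply: le_trans (hausdorff_content_cover' N Jm) _.
rewrite lee_fin ler_piMr// invf_le1 ?exprn_gt0//.
by rewrite exprn_ege1// ler1n.
Qed.

Lemma hausdorff_measure_eq0 : (#|J| < m)%N -> hausdorff_measure m E = 0%E.
Proof.
move=> Jm; have K0 : 0 <= K.
  by rewrite !mulr_ge0 ?exprn_ge0// ltW// unit_ball_volume_gt0.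
apply/eqP; rewrite eq_le hausdorff_measure_ge0 andbT.
apply: ge_ereal_sup => _ [delta /= delta0 <-].
have [N LN] := small_scale delta0.
apply/lee_addgt0Pr => e e0; rewrite add0e.
(* The first index brings the scale below [delta], the second makes [K / n.+1 <= e]; the exponent
   [m - #|J|] is at least 1. *)
pose n := maxn N (Num.truncn (K / e)).
apply: le_trans (le_hausdorff_content m E (LN n (leq_maxl _ _))) _.
apply: le_trans (hausdorff_content_cover' n (ltnW Jm)) _.
rewrite lee_fin ler_pdivrMr ?exprn_gt0//.
apply: (@le_trans _ _ (e * n.+1%:R)); last first.
  by rewrite ler_pM2l// ler_eXnr// ?ler1n// subn_gt0.
rewrite mulrC -ler_pdivrMr//; apply/ltW; apply: lt_le_trans (truncnS_gt _) _.
by rewrite ler_nat ltnS leq_maxr.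
Qed.
End covering.

End upper.

(** * Lower bounds by counting grid points *)

Lemma card_grid_box (I : finType) (N w : nat) (T : {set {ffun I -> 'I_N}}) :
  (forall a b, a \in T -> b \in T -> forall k, (a k <= b k + w)%N) ->
  (#|T| <= w.+1 ^ #|I|)%N.
Proof.
move=> Tw; have [->|[a0 a0T]] := set_0Vmem T; first by rewrite cards0.
(* Subtracting the coordinatewise minima maps [T] injectively into the box of side [w.+1]. *)
pose low k : 'I_N := (arg_min a0 (mem T) (fun a => nat_of_ord (a k))) k.
have lowP k a : a \in T -> (low k <= a k <= low k + w)%N.
  move=> aT; rewrite /low; case: arg_minnP => // b bT bmin.
  by rewrite bmin//= Tw.
pose shift (a : {ffun I -> 'I_N}) : {ffun I -> 'I_w.+1} :=
  [ffun k => inord (a k - low k)].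
have shift_inj : {in T &, injective shift}.
  move=> a b aT bT /ffunP ab; apply/ffunP => k; apply/val_inj => /=.
  have := ab k; rewrite !ffunE.
  have /andP[] := lowP k _ aT; have /andP[] := lowP k _ bT.
  move: (low k : nat) (a k : nat) (b k : nat) => lk ak bk b1 b2 a1 a2.
  by move=> /(congr1 val) /=; rewrite !inordK ?ltnS ?leq_subLR//; lia.
rewrite -(card_in_imset shift_inj); apply: leq_trans (max_card _) _.
by rewrite card_ffun card_ord.
Qed.

Section lower.
Context {R : realType} {d : nat}.
Variables (J : {set 'I_d}) (o : 'rV[R]_d) (w : 'I_d -> 'rV[R]_d) (rho : R).
Variable Q : set 'rV[R]_d.
Hypothesis rho0 : 0 < rho.
(** The coordinates in [J] of [o + sum s k *: w k] are those of [o] shifted by [s]. Thus [Q]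
    contains a parallelepiped that projects onto a cube of side [rho], and a grid can be placed in
    it. *)
Hypothesis wJ : forall l k, l \in J -> k \in J -> (w k) 0 l = (k == l)%:R.
Hypothesis QP : forall s : 'I_d -> R, (forall k, 0 <= s k <= rho) ->
  Q (o + \sum_(k in J) s k *: w k).

Let I := {l : 'I_d | l \in J}.

(** The grid of step [u = rho / N.+1] has [N.+1 ^ #|J|] points in [Q], and at most
    [((D i + u) / u) ^ #|J|] of them lie in [G i]; multiplying the count by [u ^ #|J|] gives the
    bound. *)
Let grid_le_cover n (G : nat -> set 'rV[R]_d) (D : nat -> R) (N : nat) :
  Q `<=` \bigcup_(i in `I_n) G i ->
  (forall i x y l, (i < n)%N -> G i x -> G i y -> `|x 0 l - y 0 l| <= D i) ->
  (forall i, 0 <= D i) ->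
  rho ^+ #|J| <= \sum_(i < n) (D i + rho / N.+1%:R) ^+ #|J|.
Proof.
move=> QG GD D0; pose u : R := rho / N.+1%:R.
have u0 : 0 < u by rewrite divr_gt0.
pose p (a : {ffun I -> 'I_N.+1}) : 'rV[R]_d :=
  o + \sum_(k in J) (if insub k is Some k' then (a k' : nat)%:R *
    u else 0) *: w k.
have pQ a : Q (p a).
  apply: QP => k; case: insub => [k'|]; last by rewrite lexx (ltW rho0).
  rewrite mulr_ge0 ?(ltW u0)//= /u mulrCA ler_piMr ?(ltW rho0)// ler_pdivrMr//
    mul1r.
  by rewrite ler_nat ltnW.
have pE a (l : I) : (p a) 0 (val l) = o 0 (val l) + (a l : nat)%:R * u.
  rewrite /p mxE; congr (_ + _); rewrite summxE (bigD1 (val l)) ?(valP l)//=.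
  rewrite big1 ?addr0 => [|k /andP[kJ kl]].
    by rewrite valK mxE wJ ?(valP l)// eqxx mulr1.
  by rewrite mxE wJ ?(valP l)// (negbTE kl) mulr0.
pose T (i : nat) : {set {ffun I ->
  'I_N.+1}} := finset (fun a => `[< G i (p a) >]).
have inT i a : reflect (G i (p a)) (a \in T i).
  by rewrite /T finset.in_set; exact: asboolP.
have cardT i : (i < n)%N -> #|T i|%:R <= ((D i + u) / u) ^+ #|J|.
  move=> ni; have Du : 0 <= D i / u by rewrite divr_ge0// ltW.
  have := @card_grid_box I N.+1 (Num.truncn (D i / u)) (T i).
  have -> : #|{: I}| = #|J| by rewrite card_sig; apply: eq_card.
  move=> h; apply: (@le_trans _ _ ((Num.truncn (D i / u)).+1 ^ #|J|)%:R).
    rewrite ler_nat; apply: h => a b; move=> /inT Ga /inT Gb k.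
    have := GD _ _ _ (val k) ni Ga Gb; rewrite !pE.
    rewrite opprD addrACA subrr add0r -mulrBl normrM (gtr0_norm u0).
    rewrite -ler_pdivlMr// => /(le_trans (ler_norm _)) abk.
    rewrite -leq_subLR truncn_ge_nat//.
    have [ab|/ltnW/eqP->//] := leqP (b k) (a k).
    by rewrite natrB.
  rewrite natrX lerXn2r ?nnegrE ?ler0n//;
    first by rewrite divr_ge0 ?addr_ge0 ?(ltW u0).
  rewrite -natr1 mulrDl divff ?gt_eqF// lerD2r.
  by rewrite truncn_le.
have cardN : N.+1%:R ^+ #|J| <= \sum_(i < n) #|T i|%:R :> R.
  rewrite -natr_sum -natrX ler_nat.
  apply: (@leq_trans #|(\bigcup_(i < n) T i)%SET|).
    rewrite (_ : (N.+1 ^ #|J|)%N = #|{ffun I -> 'I_N.+1}|); last first.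
      by rewrite card_ffun card_ord card_sig; congr (_ ^ _)%N; apply: eq_card.
    apply: subset_leq_card; apply/fintype.subsetP => a _.
    have [i /= ni Ga] := QG _ (pQ a).
    by apply/bigcupP; exists (Ordinal ni) => //; rewrite inE; exact/asboolP.
  elim/big_rec2 : _ => [|i A B _ h]; first by rewrite cards0.
  by apply: leq_trans (leq_card_setU _ _).1 _; rewrite leq_add2l.
rewrite -(@ler_pM2r _ (u ^- #|J|)) ?invr_gt0 ?exprn_gt0// -expr_div_n.
rewrite (_ : rho / u = N.+1%:R); last first.
  by rewrite /u invf_div mulrCA divff ?mulr1// gt_eqF.
apply: le_trans cardN _; rewrite mulr_suml; apply: ler_sum => i _.
by rewrite -expr_div_n cardT.
Qed.

(* A cover of [Q] by sets of diameters [D i] can be taken finite after a small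
   enlargement, and a set of diameter [D i] contains at most about
   [(D i / u) ^ m] points of the grid of step [u] in [Q]. *)
Lemma hausdorff_measure_gt0 m : #|J| = m -> (0 < m)%N -> compact Q ->
  (0 < hausdorff_measure m Q)%E.
Proof.
move=> Jm m0 cQ; pose c := hausdorff_const (R := R) m.
have c0 : 0 < c by exact: hausdorff_const_gt0.
(* Total cost allowed for the enlargements: after the factor [2 ^+ m] of [termle] it uses at most
   half of [rho ^+ m]. The bound by 1 makes [s ^+ m <= s] below. *)
pose eps : R := Num.min 1 (rho ^+ m / 2 ^+ m.+1).
have eps0 : 0 < eps by rewrite lt_min ltr01 divr_gt0 ?exprn_gt0.
have epsE : 2 ^+ m * eps <= rho ^+ m / 2.
  apply: (@le_trans _ _ (2 ^+ m * (rho ^+ m / 2 ^+ m.+1))).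
    by rewrite ler_pM2l ?exprn_gt0// ge_min lexx orbT.
  suff -> : 2 ^+ m * (rho ^+ m / 2 ^+ m.+1) = rho ^+ m / 2 by [].
  by rewrite exprS; field; rewrite lt0r_neq0// exprn_gt0.
apply: (@lt_le_trans _ _ (c * (rho ^+ m / 2 ^+ m.+1))%:E).
  by rewrite lte_fin mulr_gt0// divr_gt0 ?exprn_gt0.
apply: le_trans (hausdorff_content_le_measure m Q ltr01).
apply: le_ereal_inf_tmp => _ [F [QF Fd] <-].
pose D i : R := if F i == set0 then 0 else fine (ediam (F i)).
have DP i : [/\ 0 <= D i, hausdorff_gauge m (F i) = (c * D i ^+ m)%:E &
    forall x y, F i x -> F i y -> enorm (x - y) <= D i].
  rewrite /D; have [F0|/set0P F0] := eqVneq (F i) set0.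
    by rewrite F0 hausdorff_gauge0 expr0n gtn_eqF// mulr0; split => // x y [].
  have [a [/andP[a0 _] Ea ->]] := hausdorff_gaugeE m F0 (Fd i).
  by rewrite Ea; split => // x y Fx Fy; rewrite -lee_fin -Ea; exact: ediam_ge.
(* Four times [eta i] is [eps / 2 ^+ i.+1]: twice for fattening both ends of [F i], twice for the
   grid step. These errors sum to at most [eps]. *)
pose eta i : R := eps / 4 / 2 ^+ i.+1.
have eta0 i : 0 < eta i by rewrite !divr_gt0.
pose G i := \bigcup_(y in F i) ball y (eta i).
have [S _ QS] : exists2 S : {fset nat}, {subset S <= @setT nat} &
    Q `<=` \bigcup_(i in [set` S]) G i.
  move: cQ; rewrite compact_cover; apply => [i _|x /QF[i _ Fi]].
    by apply: bigcup_open => y _; exact: ball_open.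
  by exists i => //; exists x => //; exact: ballxx.
pose n := (\max_(i <- S) i).+1.
have QG : Q `<=` \bigcup_(i in `I_n) G i.
  move=> x /QS[i /= iS Gi]; exists i => //=.
  by rewrite ltnS; exact: leq_bigmax_seq.
have eta_le i : (i < n)%N -> eta n <= eta i.
  move=> ni; rewrite /eta ler_pM2l ?divr_gt0// lef_pV2 ?posrE ?exprn_gt0//.
  by rewrite ler_eXn2l ?ltr1n// ltnS ltnW.
pose N := Num.truncn (rho / (2 * eta n)).
have Nle i : (i < n)%N -> rho / N.+1%:R <= 2 * eta i.
  move=> ni; apply: (@le_trans _ _ (2 * eta n));
    last by rewrite ler_pM2l// eta_le.
  rewrite ler_pdivrMr// mulrC -ler_pdivrMr ?mulr_gt0//.
  exact/ltW/truncnS_gt.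
have GD i x y l : (i < n)%N -> G i x -> G i y ->
  `|x 0 l - y 0 l| <= D i + 2 * eta i.
  move=> _ [x' Fx]; rewrite -ball_normE /= => xx' [y' Fy].
  rewrite -ball_normE /= => yy'; have [_ _ FD] := DP i.
  rewrite (_ : x 0 l - y 0 l = (x' - y') 0 l + ((y' - y) 0 l - (x' - x) 0 l));
    last first.
    by rewrite !mxE; ring.
  apply: le_trans (ler_normD _ _) _; apply: lerD.
    by apply: le_trans (coord_le_enorm _ _) _; exact: FD.
  apply: le_trans (ler_normB _ _) _; rewrite mulr_natl mulr2n.
  by apply: lerD; apply: le_trans (coord_le_norm _ _) _; exact: ltW.
have D0 i : 0 <= D i by case: (DP i).
have := @grid_le_cover n G (fun i => D i + 2 * eta i) N QG GD.
have DE0 i : 0 <= D i + 2 * eta i by rewrite addr_ge0// mulr_ge0// ltW.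
move=> /(_ DE0); rewrite Jm => grid.
have termle (i : 'I_n) : (D i + 2 * eta i + rho / N.+1%:R) ^+ m <=
    2 ^+ m * (D i ^+ m + eps / 2 ^+ i.+1).
  have e4 : 2 * eta i + 2 * eta i = eps / 2 ^+ i.+1.
    by rewrite /eta; field; rewrite lt0r_neq0// exprn_gt0.
  have e0 : 0 < eps / 2 ^+ i.+1 by rewrite divr_gt0// exprn_gt0.
  have e1 : eps / 2 ^+ i.+1 <= 1.
    rewrite ler_pdivrMr ?exprn_gt0// mul1r (@le_trans _ _ 1)//.
      by rewrite ge_min lexx.
    by rewrite exprn_ege1// ler1n.
  set s := eps / _ in e4 e0 e1 *.
  (* The maximum replaces a convexity inequality: [(D + s) ^+ m] is at most [2 ^+ m] times the
     larger of the two powers, hence at most [2 ^+ m] times their sum. *)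
  apply: (@le_trans _ _ ((2 * Num.max (D i) s) ^+ m)).
    apply: lerXn2r; rewrite ?nnegrE ?mulr_ge0 ?le_max ?D0//.
      by rewrite !addr_ge0 ?mulr_ge0 ?invr_ge0 ?D0// ltW// eta0.
    apply: (@le_trans _ _ (D i + s)).
      by rewrite -e4 addrA lerD2l Nle.
    by rewrite mulr_natl mulr2n lerD ?le_max ?lexx ?orbT.
  rewrite exprMn ler_pM2l ?exprn_gt0//.
  have sm : s ^+ m <= s by rewrite ler_iXnr// ltW.
  have Dm : 0 <= D i ^+ m by rewrite exprn_ge0.
  by rewrite /Num.max; case: ifP => _;
    [rewrite (le_trans sm)// lerDr | rewrite lerDl ltW].
have geo k : \sum_(i < k) eps / 2 ^+ i.+1 <= eps.
  suff -> : \sum_(i < k) eps / 2 ^+ i.+1 = eps * (1 - 2 ^- k).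
    by rewrite ler_piMr ?(ltW eps0)// gerBl invr_ge0 exprn_ge0.
  elim: k => [|k IH]; first by rewrite big_ord0 expr0 invr1 subrr mulr0.
  rewrite big_ord_recr /= IH exprS; field.
  by rewrite lt0r_neq0// exprn_gt0.
have sumD : rho ^+ m / 2 ^+ m.+1 <= \sum_(i < n) D i ^+ m.
  rewrite exprSr invfM mulrA ler_pdivrMr// ler_pdivrMr ?exprn_gt0//.
  have := le_trans grid (ler_sum _ (fun i _ => termle i)).
  rewrite -mulr_sumr big_split /= mulrDr => h.
  have h2 : 2 ^+ m * (\sum_(i < n) eps / 2 ^+ i.+1) <= rho ^+ m / 2.
    by apply: le_trans epsE; rewrite ler_pM2l ?exprn_gt0.
  by move: h h2; rewrite (mulrC _ 2) => h h2; lra.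
apply: (@le_trans _ _ (\sum_(0 <= i < n) hausdorff_gauge m (F i))%E);
  last first.
  by apply: nneseries_lim_ge => i _ _; exact: hausdorff_gauge_ge0.
rewrite big_mkord (eq_bigr (fun i : 'I_n => (c * D i ^+ m)%:E)); last first.
  by move=> i _; case: (DP i).
by rewrite sumEFin lee_fin -mulr_sumr ler_pM2l.
Qed.

End lower.

(** * Normals of convex sets *)

Section normals.
Context {R : realType} {d : nat}.
Implicit Types (C Z : set 'rV[R]_d) (r p x n : 'rV[R]_d).

(** Applied also to points [r] outside [C], where it describes a plane through [r] with [C] on one
    side; normals at boundary points are obtained as limits of such normals. *)
Definition unit_normal C r n := enorm n = 1 /\ C `<=` halfspace r n.

(** If no [n] in [Z] is a normal at [p], each has a witness in [C] that still works for nearby [n]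
    and [p], and compactness of [Z] makes the neighbourhood of [p] uniform. Three choices of [Z] are
    used: the sphere for existence of normals, the directions far from [e] for flatness, and the
    complement of an open set in the sphere for measurability. *)
Lemma closed_normals C Z : compact Z ->
  closed [set p | exists2 n, Z n & C `<=` halfspace p n].
Proof.
move=> cZ; set S := [set p | _].
have : open (~` S).
  rewrite openE => p nSp; rewrite /interior.
  have /compact_near_coveringP ncZ := cZ.
  have near n : Z n -> \forall n' \near n & p' \near p,
      exists2 x, C x & 0 < dotp (x - p') n'.
    move=> Zn; have [x Cx xn] : exists2 x, C x & 0 < dotp (x - p) n.
      have /existsNP[x /not_implyP[Cx /negP]] : ~ C `<=` halfspace p n.
        by move=> h; apply: nSp; exists n.
      by rewrite -ltNge => h; exists x.
    pose f (z : 'rV[R]_d * 'rV[R]_d) := dotp (x - z.2) z.1.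
    have cf : continuous f.
      apply: (@continuous_dotp _ _ _ (fun z : 'rV[R]_d * 'rV[R]_d =>
        x - z.2) fst).
        move=> [a b]; have := cvgB (cvg_cst x) (@cvg_snd _ _ (nbhs a) (nbhs b)
          _).
        by apply.
      by move=> [a b]; exact: cvg_fst.
    have : \forall z \near (n, p), 0 < f z.
      exact: (cf (n, p) [set t | 0 < t] (open_nbhs_nbhs (conj (@open_gt _ 0)
        xn))).
    by apply: filterS => -[n' p'] /= h; exists x.
  have := ncZ _ (nbhs p) (fun p' n => exists2 x, C x & 0 < dotp (x - p') n).
  move=> /(_ (nbhs_filter p) near); apply: filterS => p' h [n Zn Cn].
  by have [x /Cn] := h _ Zn; rewrite /halfspace/= leNgt => /negP.
by move/open_closedC; rewrite setCK.
Qed.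

Lemma dotp_scaleB (a : R) (u v : 'rV[R]_d) :
  dotp (a *: u - v) (a *: u - v) =
  a * (a * dotp u u) - 2 * a * dotp u v + dotp v v.
Proof. by rewrite !dotp_lin (dotpC v u); ring. Qed.

Lemma nearest_point_normal C p : compact C -> convex_set C -> C !=set0 ->
  ~ C p -> exists n, unit_normal C p n.
Proof.
move=> cC conC C0 nCp.
have cf : continuous (fun x => dotp (x - p) (x - p)).
  by apply: continuous_dotp => z; exact: cvgB cvg_id (cvg_cst p).
have [c] := compact_EVT_min C0 cC (continuous_subspaceT cf).
rewrite inE => Cc cmin; pose v := p - c.
have v0 : v != 0 by rewrite subr_eq0; apply/eqP => pc; apply: nCp; rewrite pc.
have vpos : 0 < enorm v by rewrite lt_def enorm_eq0 v0 enorm_ge0.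
have key x : C x -> dotp (x - c) v <= 0.
  move=> Cx; rewrite leNgt; apply/negP => xv.
  pose q := dotp (x - c) (x - c).
  have q0 : 0 <= q by exact: dotp_ge0.
  (* Moving from [c] towards [x] by the fraction [a] changes the squared distance to [p] by [a]
     times [a * q - 2 * dotp (x - c) v], which is negative for this [a]. *)
  pose a := Num.min 1 (dotp (x - c) v / (q + 1)).
  have a0 : 0 < a by rewrite lt_min ltr01 divr_gt0// ltr_wpDl.
  have a1 : a <= 1 by rewrite ge_min lexx.
  have aq : a * q < 2 * dotp (x - c) v.
    have : a * (q + 1) <= dotp (x - c) v.
      by rewrite -ler_pdivlMr ?ltr_wpDl// ge_min lexx orbT.
    by lra.
  have := cmin (a *: x + (1 - a) *: c).
  rewrite inE => /(_ (convex_setP conC _ Cx Cc)).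
  rewrite (ltW a0) a1 => /(_ isT).
  rewrite (_ : a *: x + (1 - a) *: c - p = a *: (x - c) - v); last first.
    by apply/rowP => l; rewrite !mxE; ring.
  rewrite -(opprB p c) -/v dotp_scaleB -/q !dotpNl !dotpNr opprK lerDr.
  by move: aq; move: (dotp (x - c) v) => s; nra.
exists ((enorm v)^-1 *: v); split.
  by rewrite enormZ gtr0_norm ?invr_gt0// mulVf// gt_eqF.
move=> x Cx; rewrite /halfspace/= dotpZr pmulr_rle0 ?invr_gt0//.
rewrite (_ : x - p = (x - c) - v); last by rewrite /v opprB addrA subrK.
by rewrite dotpDl dotpNl subr_le0 (le_trans (key _ Cx))// dotp_ge0.
Qed.

Lemma closed_sub_boundary C : closed C -> boundary C `<=` C.
Proof. by move=> /closure_id {2}-> x []. Qed.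

(** A boundary point is a limit of points outside [C], each of which has a normal by nearest-point
    projection; [closed_normals] passes to the limit. *)
Lemma exists_unit_normal C r : compact C -> convex_set C -> C !=set0 ->
  boundary C r -> exists n, unit_normal C r n.
Proof.
move=> cC conC C0 [_]; change ((~` interior C) r ->
  exists n, unit_normal C r n); rewrite -closure_setC => rC.
suff : [set p | exists2 n, usphere n & C `<=` halfspace p n] r.
  by move=> [n n1 Cn]; exists n; split.
have /closure_id -> := @closed_normals C _ (@compact_usphere R d).
apply: closure_subset rC => p /(nearest_point_normal cC conC C0)[n [n1 Cn]].
by exists n.
Qed.

Lemma interior_absorb C x u : interior C x ->
  exists2 s : R, 0 < s & C (x + s *: u).
Proof.
move=> /nbhs_ballP[s /= s0 sC]; exists (s / 2 / (1 + `|u|)).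
  by rewrite !divr_gt0// ltr_wpDr.
apply: sC; rewrite -ball_normE /= opprD addNKr normrN normrZ.
have u1 : 0 < 1 + `|u| by rewrite ltr_wpDr.
rewrite gtr0_norm ?divr_gt0// mulrAC ltr_pdivrMr//.
by have := normr_ge0 u; move: (`|u|) => w; nra.
Qed.

Lemma interior_lt C r n x : interior C x -> unit_normal C r n ->
  dotp (x - r) n < 0.
Proof.
move=> /(interior_absorb n)[s s0 Cxs] [/enorm1 n1 /(_ _ Cxs)].
rewrite /halfspace/= !dotp_lin n1; lra.
Qed.

Lemma unit_normalN C r n : interior C !=set0 -> unit_normal C r n ->
  unit_normal C r (- n) -> False.
Proof.
move=> [x Cx] rn rnN; have := interior_lt Cx rn; have := interior_lt Cx rnN.
by rewrite dotpNr; lra.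
Qed.

Lemma hyperplane_inj r n n' : enorm n = 1 -> enorm n' = 1 ->
  hyperplane r n = hyperplane r n' -> n' = n \/ n' = - n.
Proof.
move=> /enorm1 n1 /enorm1 n1' h.
have : hyperplane r n (r + (n' - dotp n' n *: n)).
  by rewrite /hyperplane/= addrC addKr !dotp_lin n1; ring.
rewrite h /hyperplane/= addrC addKr !dotp_lin n1' (dotpC n n') => e1.
have e2 : n' - dotp n' n *: n = 0.
  by apply/eqP; rewrite -dotp_eq0 !dotp_lin n1 n1' (dotpC n n'); apply/eqP; lra.
have e3 : n' = dotp n' n *: n by apply/eqP; rewrite -subr_eq0 e2.
have /eqP : dotp n' n ^+ 2 = 1 by lra.
rewrite sqrf_eq1 => /orP[]/eqP a1; [left|right]; rewrite e3 a1.
  by rewrite scale1r.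
by rewrite scaleN1r.
Qed.

Lemma unit_normal_support C r n : unit_normal C r n ->
  support_plane C r (hyperplane r n).
Proof.
move=> [n1 Cn]; exists n; split => //.
by rewrite -enorm_eq0 n1 oner_neq0.
Qed.

Lemma support_unit_normal C r P : support_plane C r P ->
  exists2 n, unit_normal C r n & P = hyperplane r n.
Proof.
move=> [v [v0 -> Cv]].
have vpos : 0 < enorm v by rewrite lt_def enorm_eq0 v0 enorm_ge0.
exists ((enorm v)^-1 *: v).
  split; first by rewrite enormZ gtr0_norm ?invr_gt0// mulVf// gt_eqF.
  by move=> x /Cv; rewrite /halfspace/= dotpZr pmulr_rle0 ?invr_gt0.
apply/seteqP; split=> x; rewrite /hyperplane/= dotpZr; first by move=> ->;
  rewrite mulr0.
by move/eqP; rewrite mulf_eq0 invr_eq0 gt_eqF//= => /eqP.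
Qed.

(** Regularity speaks of planes, and a plane fixes its unit normal up to sign; an interior point of
    [C] excludes opposite normals. *)
Lemma regular_unit_normal_inj C r n n' : interior C !=set0 ->
  regular_point C r ->
  unit_normal C r n -> unit_normal C r n' -> n = n'.
Proof.
move=> C0 [_ [P [_ uniqP]]] rn rn'.
have h : hyperplane r n = hyperplane r n'.
  by rewrite -(uniqP _ (unit_normal_support rn)) (uniqP _ (unit_normal_support
    rn')).
have [//|n'N] := hyperplane_inj rn.1 rn'.1 h.
by case: (unit_normalN C0 rn); rewrite -n'N.
Qed.

Lemma normal_at_unit C r : regular_point C r -> unit_normal C r (normal_at C r).
Proof.
move=> [_ [P [sP _]]]; have [n rn Pn] := support_unit_normal sP.
have : exists n, exists P, support_plane C r P /\ outward_unit_normal C r P n.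
  by exists n, P; split => //; case: rn.
by move=> /(xgetPex 0)[Q [_ [n1 _ Cn]]].
Qed.

(** Two distinct unit normals are not opposite, hence independent, so some 2 by 2 minor is nonzero.
    This measures independence by a number, so that the exceptional points split into countably many
    sets indexed by [i], [j] and a lower bound for the minor. *)
Lemma nonregular_minor C r : interior C !=set0 -> compact C -> convex_set C ->
  boundary C r -> ~ regular_point C r ->
  exists n1 n2, [/\ unit_normal C r n1, unit_normal C r n2 &
    exists i j, n1 0 i * n2 0 j - n1 0 j * n2 0 i != 0].
Proof.
move=> C0 cC conC bCr nreg.
have CC0 : C !=set0 by case: C0 => x /interior_subset; exists x.
have [n1 rn1] := exists_unit_normal cC conC CC0 bCr.
have [n2 rn2 n12] : exists2 n2, unit_normal C r n2 & n1 <> n2.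
  apply: contrapT => h; apply: nreg; split => //; exists (hyperplane r n1);
    split.
    exact: unit_normal_support.
  move=> P /support_unit_normal[n rn ->].
  by have [->//|n1n] := pselect (n1 = n); case: h; exists n.
exists n1, n2; split => //; apply: contrapT => h.
have minor0 i j : n1 0 i * n2 0 j = n1 0 j * n2 0 i.
  apply/eqP; rewrite -subr_eq0; apply/negP => /negP ij0.
  by apply: h; exists i, j.
have /enorm1 e1 := rn1.1; have /enorm1 e2 := rn2.1.
have n2E : n2 = dotp n1 n2 *: n1.
  apply/rowP => i; rewrite !mxE -[LHS]mul1r -e1 !dotpE !mulr_suml.
  by apply: eq_bigr => j _; rewrite -mulrA -minor0; ring.
have /eqP : dotp n1 n2 ^+ 2 = 1.
  by rewrite -e2 {2 3}n2E !dotp_lin e1; ring.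
rewrite sqrf_eq1 => /orP[]/eqP n12E; move: n2E; rewrite n12E.
  by rewrite scale1r => n2E; apply: n12.
by rewrite scaleN1r => n2E; apply: (unit_normalN C0 rn1); rewrite -n2E.
Qed.

End normals.

(** * Points with two normals form a null set *)

Lemma cramer2_le (R : realType) (p q p' q' x y c k : R) : 0 < k ->
  `|q| <= 1 -> `|q'| <= 1 -> k <= `|p * q' - q * p'| ->
  `|p * x + q * y| <= c -> `|p' * x + q' * y| <= c -> `|x| <= 2 * c / k.
Proof.
move=> k0 q1 q1' kD a b; rewrite ler_pdivlMr//.
apply: (@le_trans _ _ (`|x| * `|p * q' - q * p'|)); first by rewrite ler_wpM2l.
rewrite -normrM (_ : x * (p * q' - q * p') = q' * (p * x +
  q * y) - q * (p' * x + q' * y)); last by ring.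
apply: le_trans (ler_normB _ _) _; rewrite !normrM mulr_natl mulr2n.
have c0 : 0 <= c by apply: le_trans a.
by apply: lerD; rewrite -[leRHS]mul1r; apply: ler_pM.
Qed.

Section sections.
Context {R : realType} {d : nat}.
Implicit Types (C : set 'rV[R]_d).

Lemma compact_nat_bound C : compact C ->
  exists M : nat, forall x i, C x -> `|x 0 i| <= M%:R.
Proof.
move=> /compact_bounded[M [_ MC]]; exists (Num.truncn (M + 1)).+1 => x i Cx.
apply: le_trans (coord_le_norm _ _) _; apply: (@le_trans _ _ (M + 1)).
  by apply: MC => //; rewrite ltrDl.
exact/ltW/truncnS_gt.
Qed.

(** The two support inequalities give [dotp (y - x) n <= 0 <= dotp (y - x) n'], so either product is
    bounded by the one with [n' - n]. Each factor [d] converts a sup norm into a Euclidean norm. *)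
Lemma normal_dotp_close C x y n n' (eta s : R) : C x -> C y ->
  unit_normal C x n -> unit_normal C y n' ->
  (forall l, `|n 0 l - n' 0 l| <= eta) -> 0 <= eta -> `|y - x| <= s ->
  `|dotp (y - x) n| <= d%:R ^+ 2 * eta * s.
Proof.
move=> Cx Cy [_ /(_ _ Cy) yn] [_ /(_ _ Cx) xn'] nn' eta0 yxs.
rewrite /halfspace /= in yn xn'.
rewrite ler0_norm//; apply: (@le_trans _ _ (dotp (y - x) (n' - n))).
  by move: xn'; rewrite !dotp_lin; lra.
apply: le_trans (dotp_le _ _) _.
apply: (@le_trans _ _ ((d%:R * s) * (d%:R * eta))); last by rewrite le_eqVlt;
  apply/orP; left; apply/eqP; ring.
apply: ler_pM; rewrite ?enorm_ge0//.
  by apply: le_trans (enorm_le_norm _) _; rewrite ler_wpM2l.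
by apply: enorm_le_coord => // l; rewrite !mxE distrC.
Qed.

Lemma sum_coord_le (n u : 'rV[R]_d) (P : pred 'I_d) (tau : R) : 0 <= tau ->
  (forall l, `|n 0 l| <= 1) -> (forall l, P l -> `|u 0 l| <= tau) ->
  `|\sum_(l | P l) u 0 l * n 0 l| <= d%:R * tau.
Proof.
move=> tau0 n1 utau; apply: le_trans (ler_norm_sum _ _ _) _.
apply: (@le_trans _ _ (\sum_(l < d) tau)).
  rewrite big_mkcond/=; apply: ler_sum => l _; case: ifP => // Pl.
  by rewrite normrM -[leRHS]mulr1; apply: ler_pM => //; exact: utau.
by rewrite sumr_const card_ord mulr_natl.
Qed.

Lemma card_setC2 (i j : 'I_d) : i != j -> #|~: [set i; j]%SET| = (d - 2)%N.
Proof. by move=> ij; rewrite cardsCs finset.setCK cards2 ij card_ord. Qed.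

(* Two such points whose pairs of normals are close to each other differ by a
   vector that is almost orthogonal to two independent directions, so that it is
   controlled by its coordinates other than [i] and [j]. *)
Lemma minor_points_null C i j k : compact C -> i != j ->
  hausdorff_measure d.-1 [set r | C r /\ exists n1 n2, [/\ unit_normal C r n1,
    unit_normal C r n2 &
    k.+1%:R^-1 <= `|n1 0 i * n2 0 j - n1 0 j * n2 0 i|]] = 0%E.
Proof.
move=> cC ij; set E := [set r | _].
have d2 : (2 <= d)%N.
  have := max_card (mem [set i; j]%SET); rewrite cards2 ij card_ord; lia.
have [M MC] := compact_nat_bound cC.
have [nn nnP] : {nn : 'rV[R]_d -> 'rV[R]_d * 'rV[R]_d & forall r, E r ->
    [/\ unit_normal C r (nn r).1, unit_normal C r (nn r).2 &
    k.+1%:R^-1 <= `|(nn r).1 0 i * (nn r).2 0 j - (nn r).1 0 j *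
      (nn r).2 0 i|]}.
  apply: (@choice _ _ (fun r nn => E r ->
    [/\ unit_normal C r nn.1, unit_normal C r nn.2 &
    k.+1%:R^-1 <= `|nn.1 0 i * nn.2 0 j - nn.1 0 j * nn.2 0 i|])) => r.
  have [[_ [n1 [n2 h]]]|nE] := pselect (E r); first by exists (n1, n2).
  by exists (0, 0).
(* This mesh gives [ceta]: in the estimate [s <= tau + c * a] below, where [a] itself contains [s],
   the term in [s] is at most [s / 2] and can be absorbed. *)
pose D : R := d%:R; pose N := (4 * k.+1 * d ^ 2)%N; pose eta : R := N.+1%:R^-1.
have eta0 : 0 < eta by rewrite invr_gt0.
pose c : R := 2 * k.+1%:R.
have c0 : 0 < c by rewrite mulr_gt0.
have ceta : c * (D ^+ 2 * eta) <= 2^-1.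
  have h : c * D ^+ 2 * 2 = N%:R by rewrite /c /D /N !natrM -natrX; ring.
  have : N%:R * eta <= 1 by rewrite ler_pdivrMr// mul1r ler_nat.
  by rewrite -h; lra.
pose key r : {ffun 'I_d -> 'I_(2 * 1 * N.+1).+1} * {ffun 'I_d ->
  'I_(2 * 1 * N.+1).+1} :=
  ([ffun l => round 1 N ((nn r).1 0 l)], [ffun l => round 1 N ((nn r).2 0 l)]).
apply: (@hausdorff_measure_eq0 _ _ _ key (~: [set i; j])%SET _ M
    (D * (2 * (1 + c * D)))).
- by rewrite !mulr_ge0 ?addr_ge0 ?mulr_ge0// ltW.
- by move=> x l [Cx _]; exact: MC.
- move=> x y tau tau0 Ex Ey [/ffunP k1 /ffunP k2] xy.
  have [nx1 nx2 minor] := nnP _ Ex; have [ny1 ny2 _] := nnP _ Ey.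
  have coord1 r n l : unit_normal C r n -> `|n 0 l| <= 1%:R.
    by move=> [n1 _]; rewrite -n1 coord_le_enorm.
  have close1 l : `|(nn x).1 0 l - (nn y).1 0 l| <= eta.
    apply: (round_eq (coord1 _ _ _ nx1) (coord1 _ _ _ ny1)).
    by have := k1 l; rewrite !ffunE.
  have close2 l : `|(nn x).2 0 l - (nn y).2 0 l| <= eta.
    apply: (round_eq (coord1 _ _ _ nx2) (coord1 _ _ _ ny2)).
    by have := k2 l; rewrite !ffunE.
  rewrite -enormN opprB; set u := y - x.
  have utau l : l \in (~: [set i; j])%SET -> `|u 0 l| <= tau.
    by move=> /xy; rewrite /u !mxE distrC.
  pose s := `|u|; pose a := D ^+ 2 * eta * s + D * tau.
  have a0 : 0 <= a.
    by rewrite addr_ge0 ?mulr_ge0 ?exprn_ge0 ?(ltW eta0) ?ler0n ?normr_ge0.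
  have split2 n n' : unit_normal C x n -> unit_normal C y n' ->
      (forall l, `|n 0 l - n' 0 l| <= eta) ->
      `|n 0 i * u 0 i + n 0 j * u 0 j| <= a.
    move=> xn yn' nn'.
    have := normal_dotp_close Ex.1 Ey.1 xn yn' nn' (ltW eta0) (lexx s).
    rewrite dotpE -/u (bigD1 i)//= (bigD1 j) 1?eq_sym//=.
    set rest := \sum_(_ | _) _ => h.
    have hr : `|rest| <= D * tau.
      apply: sum_coord_le => // [l|l /andP[li lj]];
        first exact: (coord1 _ _ _ xn).
      by apply: utau; rewrite !inE negb_or li.
    rewrite (_ : _ + _ = (u 0 i * n 0 i + (u 0 j * n 0 j + rest)) - rest);
      last by ring.
    by apply: le_trans (ler_normB _ _) _; exact: lerD.
  have s1 := split2 _ _ nx1 ny1 close1; have s2 := split2 _ _ nx2 ny2 close2.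
  have k0 : 0 < k.+1%:R^-1 :> R by rewrite invr_gt0.
  have ui := cramer2_le k0 (coord1 _ _ j nx1) (coord1 _ _ j nx2) minor s1 s2.
  have uj : `|u 0 j| <= 2 * a / k.+1%:R^-1.
    apply: (cramer2_le k0 (coord1 _ _ i nx1) (coord1 _ _ i nx2) (y := u 0 i)).
    + by rewrite distrC; exact: minor.
    + by rewrite addrC.
    + by rewrite addrC.
  have sle : s <= tau + c * a.
    have ca : 2 * a / k.+1%:R^-1 = c * a by rewrite invrK /c; ring.
    rewrite ca in ui uj; apply: norm_le_coord => [|l].
      by rewrite addr_ge0// mulr_ge0// ltW.
    have [->|li] := eqVneq l i; first by apply: le_trans ui _; rewrite lerDr.
    have [->|lj] := eqVneq l j; first by apply: le_trans uj _; rewrite lerDr.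
    apply: (@le_trans _ _ tau); last by rewrite lerDl mulr_ge0// ltW.
    by apply: utau; rewrite !inE negb_or li.
  have s2tau : s <= 2 * (1 + c * D) * tau.
    have : c * (D ^+ 2 * eta) * s <= 2^-1 * s by apply: ler_wpM2r;
      rewrite ?normr_ge0.
    by move: sle; rewrite /a; lra.
  apply: le_trans (enorm_le_norm _) _; rewrite -mulrA.
  by apply: ler_wpM2l.
- by rewrite card_setC2//; lia.
Qed.

Lemma nonregular_null C : compact C -> convex_set C -> interior C !=set0 ->
  hausdorff_measure d.-1 (boundary C `&` [set r | ~ regular_point C r]) = 0%E.
Proof.
move=> cC conC C0.
have clC : closed C by apply: compact_closed => //; exact: norm_hausdorff.
pose A (q : 'I_d * 'I_d * nat) : set 'rV[R]_d :=
  [set r | C r /\ exists n1 n2, [/\ unit_normal C r n1,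
    unit_normal C r n2 &
    q.2.+1%:R^-1 <= `|n1 0 q.1.1 * n2 0 q.1.2 - n1 0 q.1.2 * n2 0 q.1.1|]].
have A0 q : hausdorff_measure d.-1 (A q) = 0%E.
  case: q => [[i j] k]; have [->|ij] := eqVneq i j;
    last exact: minor_points_null.
  rewrite (_ : A _ = set0) ?hausdorff_measure0//.
  rewrite -subset0 => r [_ [n1 [n2 [_ _ /=]]]].
  by rewrite subrr normr0 leNgt invr_gt0 ltr0n.
pose F n := if choice.unpickle n is Some q then A q else set0.
have cover : boundary C `&` [set r | ~ regular_point C r] `<=` \bigcup_n F n.
  move=> r [bCr nreg]; have [n1 [n2 [rn1 rn2 [i [j ij]]]]] :=
    nonregular_minor C0 cC conC bCr nreg.
  have [k _ /(_ k (leqnn k)) kle] :=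
    near_infty_natSinv_lt (PosNum (etrans (normr_gt0 _) ij)).
  exists (choice.pickle (i, j, k)) => //; rewrite /F choice.pickleK; split.
    exact: closed_sub_boundary bCr.
  by exists n1, n2; split => //; exact: ltW.
apply/eqP; rewrite eq_le hausdorff_measure_ge0 andbT.
apply: le_trans (le_hausdorff_measure _ cover) _.
apply: le_trans (hausdorff_measure_subadd _ _) _.
rewrite eseries0// => n _ _; rewrite /F; case: choice.unpickle => [q|];
  first exact: A0.
exact: hausdorff_measure0.
Qed.

End sections.

(** * Hyperplane sections *)

Section plane_sections.
Context {R : realType} {d : nat}.
Implicit Types (B : set 'rV[R]_d) (o e u : 'rV[R]_d).

Lemma enorm_sum (I : finType) (P : pred I) (f : I -> 'rV[R]_d) :
  enorm (\sum_(i | P i) f i) <= \sum_(i | P i) enorm (f i).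
Proof.
elim/big_ind2 : _ => [|x a y b xa yb|//]; first by rewrite enorm0.
by apply: le_trans (enormD _ _) _; exact: lerD.
Qed.

Lemma unit_coord_neq0 e : enorm e = 1 -> exists i, e 0 i != 0.
Proof.
move=> e1; apply: contrapT => h; suff e0 : e = 0.
  by move: e1; rewrite e0 enorm0 => /esym/eqP; rewrite oner_eq0.
apply/rowP => i; rewrite mxE; apply/eqP; apply: contrapT => /negP ei.
by apply: h; exists i.
Qed.

Lemma card_setC1_ord (i : 'I_d) : #|~: [set i]%SET| = d.-1.
Proof. by rewrite cardsCs finset.setCK cards1 card_ord subn1. Qed.

Lemma dotp_eq0_coord u e i : dotp u e = 0 ->
  u 0 i * e 0 i = - \sum_(l | l != i) u 0 l * e 0 l.
Proof. by rewrite dotpE (bigD1 i)//= => /eqP; rewrite addr_eq0 => /eqP. Qed.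

(** Solving the equation of the plane for a coordinate [i] with [e 0 i != 0] makes [B] a Lipschitz
    graph over the other coordinates. *)
Lemma plane_section_finite B e o (M : nat) (h : R) : enorm e = 1 ->
  (forall x i, B x -> `|x 0 i| <= M%:R) -> (forall x, B x ->
    dotp (x - o) e = h) ->
  (hausdorff_measure d.-1 B < +oo)%E.
Proof.
move=> e1 BM Be; have [i ei] := unit_coord_neq0 e1.
have ai : 0 < `|e 0 i| by rewrite normr_gt0.
pose D : R := d%:R.
apply: (@hausdorff_measure_lt_pinfty _ _ _ (fun=> tt) (~: [set i])%SET _ M
  (D * (1 + D / `|e 0 i|))) => //.
- by rewrite mulr_ge0// addr_ge0// divr_ge0.
- move=> x y tau tau0 Bx By _ xy; set u := x - y.
  have ue : dotp u e = 0.
    rewrite (_ : u = (x - o) - (y - o)); last by rewrite /u opprB addrA subrK.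
    by rewrite dotpDl dotpNl !Be// subrr.
  have ul l : l != i -> `|u 0 l| <= tau.
    by move=> li; rewrite /u !mxE; apply: xy; rewrite !inE.
  rewrite -mulrA; apply: enorm_le_coord.
    by rewrite mulr_ge0// addr_ge0// divr_ge0.
  move=> l; have [->|li] := eqVneq l i; last first.
    by apply: le_trans (ul _ li) _;
      rewrite mulrDl mul1r lerDl mulr_ge0// divr_ge0.
  have h1 : `|u 0 i| * `|e 0 i| <= D * tau.
    rewrite -normrM (dotp_eq0_coord i ue) normrN.
    by apply: sum_coord_le => // k; rewrite -e1 coord_le_enorm.
  rewrite -ler_pdivlMr// in h1; apply: le_trans h1 _.
  by rewrite mulrDl mul1r mulrAC lerDr.
- by rewrite card_setC1_ord.
Qed.

Lemma plane_section_gt0 B e o (rho : R) : (2 <= d)%N -> enorm e = 1 ->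
  0 < rho ->
  compact B -> (forall u, dotp u e = 0 -> enorm u <= rho -> B (o + u)) ->
  (0 < hausdorff_measure d.-1 B)%E.
Proof.
move=> d2 e1 rho0 cB Bu; have [i ei] := unit_coord_neq0 e1.
(* For [k != i] these form the basis of the hyperplane orthogonal to [e] whose coordinates other
   than [i] are those of the standard basis. *)
pose w (k : 'I_d) : 'rV[R]_d := delta_mx 0 k - (e 0 k / e 0 i) *: delta_mx 0 i.
have we k : dotp (w k) e = 0.
  rewrite /w dotpDl dotpNl dotpZl !dotpE.
  rewrite (bigD1 k)//= big1 => [|l lk];
    last by rewrite !mxE (negbTE lk) andbF mul0r.
  rewrite (bigD1 i)//= big1 => [|l li];
    last by rewrite !mxE (negbTE li) andbF mul0r.
  by rewrite !mxE !eqxx !mul1r !addr0 divfK// subrr.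
(* Dividing [rho] by [W] keeps the parallelepiped spanned by the [w k] inside the ball of radius
   [rho]. *)
pose W : R := 1 + \sum_k enorm (w k).
have W0 : 0 < W by rewrite ltr_pwDl// sumr_ge0// => k _; exact: enorm_ge0.
pose sc : R := rho / W; have sc0 : 0 < sc by rewrite divr_gt0.
apply: (@hausdorff_measure_gt0 _ _ (~: [set i])%SET o w sc) => //.
- move=> l k; rewrite !inE => li ki;
  rewrite /w !mxE (negbTE li) andbF mulr0 subr0.
  by rewrite eq_sym.
- move=> s hs; apply: Bu.
    elim/big_ind : _ => [|x y x0 y0|k _]; first by rewrite dotp0l.
      by rewrite dotpDl x0 y0 addr0.
    by rewrite dotpZl we mulr0.
  apply: le_trans (enorm_sum _ _) _.
  apply: (@le_trans _ _ (\sum_k sc * enorm (w k))).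
    rewrite big_mkcond /=; apply: ler_sum => k _; have /andP[s0 s1] := hs k.
    case: ifP => _; last by rewrite mulr_ge0 ?enorm_ge0// ltW.
    by rewrite enormZ ger0_norm// ler_wpM2r// enorm_ge0.
  rewrite -mulr_sumr /sc mulrAC ler_pdivrMr// ler_pM2l//.
  by rewrite /W lerDr.
- by rewrite card_setC1_ord.
- by case: d d2 => [|[]].
Qed.

Definition homothety o (lambda : R) B : set 'rV[R]_d :=
  [set x | exists2 y, B y & x = o + lambda *: (y - o)].

Lemma homothetyP o (lambda : R) B x : lambda != 0 ->
  homothety o lambda B x <-> B (o + lambda^-1 *: (x - o)).
Proof.
have cancel (a b : R) y : a * b = 1 -> o + a *: (o + b *: (y - o) - o) = y.
  by move=> ab; rewrite (addrC o (b *: _)) addrK scalerA ab scale1r addrC subrK.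
move=> l0; split=> [[y By ->]|h]; first by rewrite cancel// mulVf.
by exists (o + lambda^-1 *: (x - o)) => //; rewrite cancel// divff.
Qed.

Lemma continuous_homothety o (lambda : R) :
  continuous (fun x : 'rV[R]_d => o + lambda *: (x - o)).
Proof.
move=> x; have c : lambda *: (y - o) @[y --> x] --> lambda *: (x - o).
  have := @cvgZl_tmp R 'rV[R]_d _ _ _ lambda _ _
    (cvgB (@cvg_id _ (nbhs x)) (cvg_cst o)).
  by apply.
exact: (cvgD (cvg_cst _) c).
Qed.

(** The homothety and its inverse multiply all distances by exact factors, so the Lipschitz bound
    applies in both directions. *)
Lemma hausdorff_measure_homothety m o (lambda : R) B : 0 < lambda ->
  hausdorff_measure m (homothety o lambda B) = ((lambda ^+ m)%:E *
    hausdorff_measure m B)%E.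
Proof.
move=> l0; apply/eqP; rewrite eq_le; apply/andP; split.
  apply: (@hausdorff_measure_lip _ _ _ _ _ (fun x =>
    o + lambda^-1 *: (x - o))) => //.
    by move=> x; rewrite homothetyP// gt_eqF.
  move=> x y _ _; rewrite opprD addrACA subrr add0r -scalerBr enormZ [in
    leRHS]opprB [in leRHS]addrA subrK.
  by rewrite gtr0_norm ?invr_gt0// mulrA divff ?mul1r// gt_eqF.
rewrite -lee_pdivlMl ?exprn_gt0//.
have l0' : 0 < lambda^-1 by rewrite invr_gt0.
rewrite -exprVn.
apply: (@hausdorff_measure_lip _ _ _ _ _ (fun x =>
  o + lambda *: (x - o))) => //.
  by move=> x Bx; exists x.
move=> x y _ _; rewrite opprD addrACA subrr add0r -scalerBr enormZ [in
  leRHS]opprB [in leRHS]addrA subrK.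
by rewrite gtr0_norm// mulrA mulVf ?mul1r// gt_eqF.
Qed.

End plane_sections.

(** * Caps of a convex body at a regular point *)

Lemma bernoulli_power (R : realType) (m : nat) (s : R) : 0 <= s <= 1 ->
  1 - m%:R * s <= (1 - s) ^+ m.
Proof.
move=> /andP[s0 s1]; elim: m => [|m IH]; first by rewrite mul0r subr0 expr0.
rewrite exprS; apply: (@le_trans _ _ ((1 - s) * (1 - m%:R * s))).
  have : 0 <= m%:R * s * s by rewrite !mulr_ge0.
  by rewrite -natr1; lra.
by rewrite ler_wpM2l// subr_ge0.
Qed.

(** The choice [m.+1 * s = zeta / (1 + zeta)] and Bernoulli give [(1 - s) ^+ m >= 1 / (1 + zeta)],
    and [1 + s <= 1 / (1 - s)] turns this into the upper bound. *)
Lemma power_near1 (R : realType) (m : nat) (zeta : R) : 0 < zeta ->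
  exists s : R, [/\ 0 < s < 1, (1 + s) ^+ m <= 1 +
    zeta & 1 - zeta <= (1 - s) ^+ m].
Proof.
move=> z0; have z1 : 0 < 1 + zeta by rewrite addr_gt0.
pose s := zeta / (1 + zeta) / m.+1%:R.
have sm : m.+1%:R * s = zeta / (1 + zeta) by rewrite /s mulrC divfK.
have s0 : 0 < s by rewrite !divr_gt0.
have zz : zeta / (1 + zeta) < 1 by rewrite ltr_pdivrMr// mul1r ltrDr.
have ms0 : 0 <= m%:R * s by rewrite mulr_ge0// ltW.
have sm' : m%:R * s + s = zeta / (1 + zeta) by rewrite -sm -natr1; ring.
have s1 : s < 1 by lra.
have b : 1 - zeta / (1 + zeta) <= (1 - s) ^+ m.
  apply: le_trans (@bernoulli_power R m s _); last by rewrite (ltW s0) (ltW s1).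
  by lra.
have bE : 1 - zeta / (1 + zeta) = (1 + zeta)^-1 by field; rewrite gt_eqF.
exists s; split; first by rewrite s0.
  rewrite -[leRHS]invrK -bE; apply: (@le_trans _ _ (((1 - s) ^+ m)^-1)).
    rewrite -exprVn; apply: lerXn2r;
      rewrite ?nnegrE ?addr_ge0 ?invr_ge0 ?subr_ge0 ?(ltW s0) ?(ltW s1)//.
    rewrite -[leRHS]mul1r ler_pdivlMr ?subr_gt0//.
    by have : 0 < s * s by [rewrite mulr_gt0]; lra.
  by rewrite lef_pV2 ?posrE ?exprn_gt0 ?subr_gt0// bE invr_gt0.
apply: le_trans b; have : zeta / (1 + zeta) <= zeta; last by lra.
by rewrite ler_pdivrMr// mulrDr mulr1 lerDl mulr_ge0// ltW.
Qed.

Section cap.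
Context {R : realType} {d : nat}.
Variables (C : set 'rV[R]_d) (r0 e : 'rV[R]_d).
Hypotheses (cC : compact C) (conC : convex_set C) (C0 : interior C !=set0).
Hypotheses (regr0 : regular_point C r0) (r0e : unit_normal C r0 e).

Let ee : dotp e e = 1. Proof. by apply/enorm1; case: r0e. Qed.
Let CC0 : C !=set0. Proof. by case: C0 => x /interior_subset; exists x. Qed.
Let clC : closed C. Proof. by apply: compact_closed => //;
  exact: norm_hausdorff. Qed.

Let Cr0 : C r0. Proof. by apply: closed_sub_boundary => //; case: regr0. Qed.

(** If [p = r0 - t *: e + u] were outside [C], some unit [n] would be a normal at [p]. Uniqueness at
    [r0] and [closed_normals] force [n] to be within [eps] of [e], so [dotp e n >= 1/2]. But [r0] in
    [C] gives [t * dotp e n <= dotp u n = dotp u (n - e) <= K * t * eps < t / 2]. *)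
Lemma flat_at_regular (K : R) : 0 < K -> exists2 delta : R, 0 < delta &
  forall t u, 0 < t < delta -> dotp u e = 0 -> enorm u <= K * t ->
    C (r0 - t *: e + u).
Proof.
move=> K0; pose eps : R := Num.min 1 (2 * (K + 1))^-1.
have eps0 : 0 < eps by rewrite lt_min ltr01 invr_gt0 mulr_gt0// addr_gt0.
have epsK : K * eps < 2^-1.
  have : eps * (2 * (K + 1)) <= 1.
    by rewrite -ler_pdivlMr ?mulr_gt0 ?addr_gt0// mul1r ge_min lexx orbT.
  by nra.
have eps1 : eps <= 1 by rewrite ge_min lexx.
pose Z : set 'rV[R]_d := @usphere R d `&` [set n | eps <= enorm (n - e)].
have cZ : compact Z.
  apply: compact_closedI; first exact: compact_usphere.
  apply: (@preimage_closed 'rV[R]_d R (fun n =>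
    enorm (n - e)) [set t : R | eps <= t]); last exact: closed_ge.
  move=> n _; have cn : {for n, continuous (fun n : 'rV[R]_d => n - e)}.
    exact: cvgB cvg_id (cvg_cst e).
  exact: (continuous_comp cn (@continuous_enorm R d _)).
have clZ := @closed_normals R d C Z cZ.
set SZ := [set p | _] in clZ.
have nSZ : (~` SZ) r0.
  move=> [n [n1 ne] Cn]; have := regular_unit_normal_inj C0 regr0 r0e (conj n1
    Cn).
  by move=> en; move: ne; rewrite /= en subrr enorm0 leNgt eps0.
have : nbhs r0 (~` SZ) by apply: open_nbhs_nbhs; split => //;
  exact: closed_openC.
move=> /nbhs_ballP[rho /= rho0 ballSZ].
exists (rho / (1 + K)); first by rewrite divr_gt0// addr_gt0.
move=> t u /andP[t0 tdelta] ue uK; apply: contrapT => nCp.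
set p := r0 - t *: e + u in nCp.
have [n [n1 Cn]] := nearest_point_normal cC conC CC0 nCp.
have r0p : r0 - p = t *: e - u by apply/rowP => l; rewrite !mxE; ring.
have nSZp : ~ SZ p.
  apply: ballSZ; rewrite -ball_normE /= r0p.
  apply: le_lt_trans (norm_le_enorm _) _;
    rewrite -[ltRHS](@divfK _ (1 + K)) ?gt_eqF ?addr_gt0//.
  apply: (@le_lt_trans _ _ (t * (1 + K))).
    apply: le_trans (enormD _ _) _; rewrite enormN enormZ gtr0_norm//.
    by rewrite r0e.1 mulr1 mulrDr mulr1 lerD2l mulrC.
  by rewrite ltr_pM2r// addr_gt0.
have ne : enorm (n - e) < eps.
  by rewrite ltNge; apply/negP => h; apply: nSZp; exists n.
have /enorm1 nn := n1.
have h1 : t * dotp e n <= dotp u n.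
  have := Cn _ Cr0; rewrite /halfspace/= r0p.
  by rewrite !dotp_lin; lra.
have h2 : dotp u n <= K * t * eps.
  rewrite -[leLHS]subr0 -ue -dotpNr -dotpDr; apply: le_trans (dotp_le _ _) _.
  by apply: ler_pM; rewrite ?enorm_ge0// ltW.
have h3 : 1 - 2^-1 <= dotp e n.
  have : dotp (n - e) (n - e) <= eps ^+ 2 by rewrite -ler_enorm ltW.
  by rewrite !dotp_lin nn ee (dotpC n e) expr2; nra.
by nra.
Qed.

(** A point of [C] straight below [r0] has two uses: it is the apex from which the cap is projected
    into [B_t], and it keeps normals of the cap away from [- e]. *)
Lemma deep_point : exists2 T : R, 0 < T & C (r0 - T *: e).
Proof.
have [delta delta0 h] := flat_at_regular ltr01.
exists (delta / 2); first by rewrite divr_gt0.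
rewrite -[_ - _]addr0; apply: h.
- by rewrite divr_gt0//= ltr_pdivrMr// ltr_pMr// ltr1n.
- exact: dotp0l.
- by rewrite enorm0 mul1r divr_ge0// ltW.
Qed.

Lemma enorm_bound : exists2 M : R, 0 < M & forall x y, C x -> C y ->
  enorm (x - y) <= M.
Proof.
have [M MC] := compact_nat_bound cC.
exists (d%:R * (M%:R + M%:R) + 1);
  first by rewrite ltr_wpDl// mulr_ge0// addr_ge0.
move=> x y Cx Cy; apply: (@le_trans _ _ (d%:R * (M%:R + M%:R)));
  last by rewrite lerDl.
apply: enorm_le_coord; first by rewrite addr_ge0.
by move=> i; rewrite !mxE; apply: le_trans (ler_normB _ _) _; rewrite lerD// MC.
Qed.

(** Keeps the denominator of [tilt] away from zero: if [n] were close to [- e], the deep point would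
    lie beyond the supporting plane at [r]. *)
Lemma normal_height T : 0 < T -> C (r0 - T *: e) ->
  exists2 c : R, 0 < c <= 1 & forall r n, C r -> - (T / 2) <= dotp (r - r0) e ->
    unit_normal C r n -> c <= 1 + dotp n e.
Proof.
move=> T0 CT; have [M M0 MC] := enorm_bound.
exists (Num.min (1 / 2) (T ^+ 2 / (32 * M ^+ 2))).
  rewrite lt_min divr_gt0 ?divr_gt0 ?mulr_gt0 ?exprn_gt0//=.
  by rewrite ge_min; apply/orP; left; lra.
move=> r n Cr hr [/enorm1 nn /(_ _ CT)]; rewrite /halfspace/= => qn.
rewrite ge_min; have [a2|a2] := leP (- (1 / 2)) (dotp n e).
  by apply/orP; left; lra.
apply/orP; right; rewrite ler_pdivrMr ?mulr_gt0 ?exprn_gt0//.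
set a := dotp n e in a2 *.
(* Let [q] be the deep point and [a <= -1/2]. Pairing [q - r] with the part of [n] orthogonal to [e]
   gives a number at most [- T / 4], so [T ^+ 2 / 16 <= M ^+ 2 * (1 - a ^+ 2) <= 2 * M ^+ 2 * (1 +
   a)]; hence the constant 32. *)
have cs := cauchy_schwarz (r0 - T *: e - r) (n - a *: e).
have e1 : dotp (n - a *: e) (n - a *: e) = 1 - a ^+ 2.
  by rewrite !dotp_lin nn ee (dotpC e n) -/a; ring.
have e2 : dotp (r0 - T *: e - r) (n - a *: e) =
    dotp (r0 - T *: e - r) n + a * (T + dotp (r - r0) e).
  by rewrite !dotp_lin ee; ring.
have q2 : dotp (r0 - T *: e - r) (r0 - T *: e - r) <= M ^+ 2.
  by rewrite -ler_enorm ?MC// ltW.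
have q0 := dotp_ge0 (r0 - T *: e - r).
have a1 : a ^+ 2 <= 1.
  by have := dotp_ge0 (n - a *: e); rewrite e1 subr_ge0.
rewrite e1 e2 in cs.
have h1 : dotp (r0 - T *: e - r) n + a * (T +
  dotp (r - r0) e) <= - (T / 4) by nra.
have h2 : (T / 4) ^+ 2 <= (dotp (r0 - T *: e - r) n + a * (T +
  dotp (r - r0) e)) ^+ 2.
  by rewrite !expr2; nra.
have h3 : (T / 4) ^+ 2 <= M ^+ 2 * (1 - a ^+ 2).
  apply: le_trans h2 _; apply: le_trans cs _; apply: ler_wpM2r => //.
  by rewrite subr_ge0.
have h4 : 1 - a ^+ 2 <= 2 * (1 + a) by rewrite expr2; nra.
have M2 : 0 < M ^+ 2 by rewrite exprn_gt0.
move: h3 h4 M2; rewrite !expr2; move: (M * M) => MM; nra.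
Qed.

(* The stereographic projection of the unit vector [n] from [- e]: its length
   is [tan (theta / 2)], where [theta] is the angle between [n] and [e]. *)
Definition tilt n : 'rV[R]_d := (1 + dotp n e)^-1 *: (n - dotp n e *: e).

Lemma tilt_perp n : dotp (tilt n) e = 0.
Proof. by rewrite /tilt !dotp_lin ee; ring. Qed.

Lemma tilt_decomp n : 0 < 1 + dotp n e ->
  n = (1 + dotp n e) *: tilt n + dotp n e *: e.
Proof. by move=> a0; rewrite /tilt scalerA divff ?gt_eqF// scale1r subrK. Qed.

Lemma sqr_tilt n : enorm n = 1 -> 0 < 1 + dotp n e ->
  (1 + dotp n e) * dotp (tilt n) (tilt n) = 1 - dotp n e.
Proof.
move=> /enorm1 nn a0; rewrite /tilt !dotp_lin nn ee (dotpC e n).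
by field; rewrite gt_eqF.
Qed.

Let ht r := dotp (r - r0) e.

(** An unfolding: the plane through [r] normal to [n] is turned about its intersection with the
    support plane at [r0] until it lies in that plane, then lowered by [t]. Horizontally this moves
    [r] by [|h| / sin theta - |h| cot theta = |h| tan (theta / 2)], where [h = ht r]. *)
Definition flatten t r n : 'rV[R]_d := r - (ht r + t) *: e - ht r *: tilt n.

(* With [w = r - r'] and [k], [k'] the tilts, the difference of the squared
   norms is at least [h h' |k - k'|^2]: the support inequalities bound
   [<w, k>] and [<w, k'>], and [2 <n, e> / (1 + <n, e>) = 1 - |k|^2]. *)
Lemma flatten_expansive t r r' n n' : C r -> C r' ->
  unit_normal C r n -> unit_normal C r' n' ->
  0 < 1 + dotp n e -> 0 < 1 + dotp n' e ->
  enorm (r - r') <= enorm (flatten t r n - flatten t r' n').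
Proof.
move=> Cr Cr' [n1 Cn] [n1' Cn'] a0 a0'.
have hr : ht r <= 0 by exact: r0e.2.
have hr' : ht r' <= 0 by exact: r0e.2.
have s := sqr_tilt n1 a0; have s' := sqr_tilt n1' a0'.
have p := tilt_perp n; have p' := tilt_perp n'.
have := Cn _ Cr'; have := Cn' _ Cr; rewrite /halfspace/=.
rewrite {1}(tilt_decomp a0) {1}(tilt_decomp a0').
have hd : ht r - ht r' = dotp (r - r') e by rewrite /ht !dotp_lin; ring.
rewrite le_enorm /flatten.
move: (tilt n) (tilt n') s s' p p' hr hr' hd.
move: (dotp n e) (dotp n' e) (ht r) (ht r') a0 a0'.
move=> a a' h h' a0 a0' k k' s s' p p' hr hr' hd.
rewrite (_ : r' - r = - (r - r')); last by rewrite opprB.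
rewrite (_ : r - _ - _ - _ = (r - r') - (h - h') *: e - (h *: k - h' *: k'));
  last first.
  by apply/rowP => l; rewrite !mxE; ring.
move: (r - r') hd => w hd.
rewrite !dotp_lin ee p p' (dotpC e k) (dotpC e k') p p' (dotpC e w) -hd.
rewrite (dotpC k w) (dotpC k' w) (dotpC k' k) => w1 w2.
have kk := dotp_ge0 (k - k'); move: kk; rewrite !dotp_lin (dotpC k' k).
move: s s' w1 w2; move: (dotp k k) (dotp k' k') (dotp k k') (dotp w k) (dotp w
  k') (dotp w w).
move=> q q' kk wk wk' ww s s' w1 w2 kk0.
have q1 : 0 < 1 + q by rewrite -(pmulr_rgt0 _ a0); lra.
have q1' : 0 < 1 + q' by rewrite -(pmulr_rgt0 _ a0'); lra.
have W : 0 <= 2 * wk + (1 - q) * (h - h').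
  rewrite (_ : _ + _ = (1 + q) * ((1 + a) * wk + a * (h - h'))); last first.
    by have := congr1 (fun z => z * wk) s;
      have := congr1 (fun z => z * (h - h')) s; lra.
  by rewrite mulr_ge0 ?(ltW q1)//; lra.
have W' : 2 * wk' + (1 - q') * (h - h') <= 0.
  rewrite (_ : _ + _ = (1 + q') * ((1 + a') * wk' + a' * (h - h'))); last first.
    by have := congr1 (fun z => z * wk') s';
      have := congr1 (fun z => z * (h - h')) s'; lra.
  by rewrite pmulr_rle0.
(* The difference of the squared norms is exactly the sum of the left factors bounded in [Wh], [Wh']
   and [hh']. *)
have Wh : 0 <= - h * (2 * wk + (1 - q) *
  (h - h')) by rewrite mulr_ge0// oppr_ge0.
have Wh' : 0 <= h' * (2 * wk' + (1 - q') * (h - h')) by rewrite mulr_le0.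
have hh' : 0 <= h * h' * (q - kk - (kk - q')) by rewrite mulr_ge0// mulr_le0.
by rewrite -subr_ge0; lra.
Qed.

Let base := cap_base C r0 e.
Let center t := r0 - t *: e.

Lemma base_convex t x y (a : R) : 0 <= a <= 1 -> base t x -> base t y ->
  base t (a *: x + (1 - a) *: y).
Proof.
move=> a01 [Cx xt] [Cy yt]; split; first exact: convex_setP.
rewrite /= in xt yt *.
rewrite (_ : a *: x + (1 - a) *: y - r0 = a *: (x - r0) +
  (1 - a) *: (y - r0)); last first.
  by apply/rowP => l; rewrite !mxE; ring.
by rewrite dotpDl !dotpZl xt yt; ring.
Qed.

(** By convexity [mu B + nu B] lies in [(mu + nu) B], with dilations about the center; here [u] is
    [nu] times a vector of the ball contained in [B_t]. *)
Lemma homothety_base_add t (K mu nu : R) x u : 0 < t -> 0 < mu -> 0 < nu ->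
  (forall u, dotp u e = 0 -> enorm u <= K * t -> C (center t + u)) ->
  homothety (center t) mu (base t) x -> dotp u e = 0 ->
    enorm u <= nu * (K * t) ->
  homothety (center t) (mu + nu) (base t) (x + u).
Proof.
move=> t0 mu0 nu0 ball_t [y By ->] ue uK.
pose z := center t + nu^-1 *: u.
have Bz : base t z.
  split.
    apply: ball_t; first by rewrite dotpZl ue mulr0.
    by rewrite enormZ gtr0_norm ?invr_gt0// ler_pdivrMl.
  rewrite /= /z /center (_ : _ - r0 = nu^-1 *: u - t *: e); last first.
    by apply/rowP => l; rewrite !mxE; ring.
  by rewrite dotpDl dotpNl !dotpZl ue ee; ring.
have mn : 0 < mu + nu by rewrite addr_gt0.
pose a := mu / (mu + nu).
exists (a *: y + (1 - a) *: z).
  apply: base_convex => //; rewrite divr_ge0 ?(ltW mu0) ?(ltW mn)//=.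
  by rewrite ler_pdivrMr// mul1r lerDl ltW.
rewrite /z /a; apply/rowP => l; rewrite !mxE.
by field; rewrite !gt_eqF.
Qed.

Lemma homothety_base_le t (mu mu' : R) x : base t (center t) -> 0 < mu ->
  mu <= mu' ->
  homothety (center t) mu (base t) x -> homothety (center t) mu' (base t) x.
Proof.
move=> Bo mu0 mumu' [y By ->].
have mu'0 : 0 < mu' by apply: lt_le_trans mumu'.
pose a := mu / mu'.
exists (a *: y + (1 - a) *: center t).
  apply: base_convex => //; rewrite divr_ge0 ?(ltW mu0) ?(ltW mu'0)//=.
  by rewrite ler_pdivrMr// mul1r.
rewrite /a; apply/rowP => l; rewrite !mxE.
by field; rewrite !gt_eqF.
Qed.

(** The segment from [r] to the deep point stays in [C] and crosses the plane of [B_t]; similar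
    triangles give the ratio [(T + ht r) / (T - t)], at most [T / (T - t)] since [ht r <= 0]. *)
Lemma projection_homothety T t r : 0 < t < T -> C (r0 - T *: e) -> C r ->
  - t <= ht r -> base t (center t) ->
  homothety (center t) (T / (T - t)) (base t) (r - (ht r + t) *: e).
Proof.
move=> /andP[t0 tT] CT Cr hr Bo.
have hr0' : ht r <= 0 by exact: r0e.2.
have Tt : 0 < T - t by rewrite subr_gt0.
have Th : 0 < T + ht r by lra.
apply: (@homothety_base_le _ ((T + ht r) / (T - t))) => //.
- by rewrite divr_gt0.
- by rewrite ler_pM2r ?invr_gt0// gerDl.
pose a := (T - t) / (T + ht r).
exists (a *: r + (1 - a) *: (r0 - T *: e)).
  split.
    apply: convex_setP => //; rewrite divr_ge0 ?(ltW Tt) ?(ltW Th)//=.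
    by rewrite ler_pdivrMr// mul1r; lra.
  rewrite /= (_ : _ - r0 = a *: (r - r0) - ((1 - a) * T) *: e); last first.
    by apply/rowP => l; rewrite !mxE; ring.
  rewrite dotpDl dotpNl !dotpZl ee mulr1 -/(ht r) /a.
  by field; rewrite gt_eqF.
rewrite /a /center; apply/rowP => l; rewrite !mxE.
by field; rewrite !gt_eqF.
Qed.

(** Since [|tilt n|^2 = (1 - a) / (1 + a) <= 2 / c] with [a = dotp n e], the shift has length at
    most [t * L], which fits into [nu] times the ball of radius [K * t]. *)
Lemma flatten_in T t (c K L nu : R) r n : 0 < t < T -> C (r0 - T *: e) -> C r ->
  - t <= ht r -> unit_normal C r n -> 0 < c <= 1 + dotp n e ->
  0 <= L -> 2 <= c * L ^+ 2 -> 0 < nu -> L <= nu * K -> 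
  (forall u, dotp u e = 0 -> enorm u <= K * t -> C (center t + u)) ->
  base t (center t) ->
  homothety (center t) (T / (T - t) + nu) (base t) (flatten t r n).
Proof.
move=> tT CT Cr hr [n1 _] /andP[c0 cn] L0 cL nu0 LK ball_t Bo.
have /andP[t0 tT'] := tT.
have hr0' : ht r <= 0 by exact: r0e.2.
apply: (@homothety_base_add t K) => //.
- by rewrite divr_gt0 ?subr_gt0// (lt_trans t0).
- exact: (projection_homothety tT).
- by rewrite dotpNl dotpZl tilt_perp mulr0 oppr0.
rewrite enormN enormZ ler0_norm//.
have a0 : 0 < 1 + dotp n e by apply: lt_le_trans cn.
have kL : enorm (tilt n) <= L.
  have k := sqr_tilt n1 a0; have k0 := dotp_ge0 (tilt n).
  rewrite ler_enorm// -(ler_pM2l c0); apply: le_trans cL.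
  apply: (@le_trans _ _ ((1 + dotp n e) * dotp (tilt n) (tilt n))).
    by rewrite ler_wpM2r.
  by rewrite k; lra.
apply: (@le_trans _ _ (t * L)).
  by apply: ler_pM; rewrite ?enorm_ge0 ?oppr_ge0//; lra.
by rewrite mulrA mulrC ler_pM2r.
Qed.

(** If the flattened point were in the small copy, adding [eta] times a vector of length [K * t]
    along the horizontal part of [n] would give a point of [C] by convexity. That point violates the
    support inequality at [r]: its product with [n] exceeds [t - t * dotp n e - ht r >= 0]. *)
Lemma flatten_notin t (K eta : R) r n : 0 < t -> 0 < eta < 1 -> C r ->
  - t <= ht r -> unit_normal C r n -> 0 < 1 + dotp n e -> 0 < K ->
  1 < eta * K * enorm (n - dotp n e *: e) ->
  (forall u, dotp u e = 0 -> enorm u <= K * t -> C (center t + u)) ->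
  ~ homothety (center t) (1 - eta) (base t) (flatten t r n).
Proof.
move=> t0 /andP[eta0 eta1] Cr hr [n1 Cn] a0 K0 big ball_t [x [Cx _] yx].
have hr0' : ht r <= 0 by exact: r0e.2.
set n' := n - _ *: e in big; set b := enorm n' in big.
have b0 : 0 < b.
  rewrite lt_def enorm_ge0 andbT; apply/eqP => bz.
  by move: big; rewrite bz mulr0 ltNge ler01.
pose u := (K * t / b) *: n'.
have n'e : dotp n' e = 0 by rewrite /n' !dotp_lin ee; ring.
have /enorm1 nn := n1.
have n'n : dotp n' n = b ^+ 2.
  by rewrite sqr_enorm /n' !dotp_lin nn ee (dotpC e n); ring.
have Cz : C (center t + u).
  apply: ball_t; first by rewrite dotpZl n'e mulr0.
  by rewrite enormZ gtr0_norm ?divr_gt0 ?mulr_gt0// divfK// gt_eqF.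
have := Cn _ (convex_setP conC (_ : 0 <= 1 - eta <= 1) Cx Cz).
have -> : (1 - eta) *: x + (1 - (1 - eta)) *: (center t + u) =
    flatten t r n + eta *: u.
  by rewrite yx; apply/rowP => l; rewrite !mxE; ring.
have eta01 : 0 <= 1 - eta <= 1 by rewrite subr_ge0 ltW//= gerBl ltW.
move=> /(_ eta01); rewrite /halfspace/=.
rewrite (_ : _ - r = (eta * (K * t / b)) *: n' - (ht r +
  t) *: e - ht r *: tilt n); last first.
  by rewrite /flatten /u; apply/rowP => l; rewrite !mxE; ring.
have kn : dotp (tilt n) n = 1 - dotp n e.
  rewrite {2}(tilt_decomp a0) dotpDr (dotpZr (1 +
    _)) (dotpZr _ e) tilt_perp mulr0 addr0.
  exact: sqr_tilt.
rewrite 2!dotpDl 2!dotpNl.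
rewrite (dotpZl _ n') (dotpZl _ e) (dotpZl _ (tilt n)) n'n kn (dotpC e n).
have -> : eta * (K * t / b) * b ^+ 2 = t * (eta * K * b) by field;
  rewrite gt_eqF.
have a1 : dotp n e <= 1.
  by apply: le_trans (dotp_le _ _) _; rewrite n1 r0e.1 mulr1.
have : t < t * (eta * K * b) by rewrite ltr_pMr.
have : t * dotp n e <= t by rewrite ler_piMr// ltW.
by lra.
Qed.

(** With [a = dotp n e], the horizontal part of [n] has squared length [(1 + a) * (1 - a)], while
    [|n - e|^2 = 2 * (1 - a)]. *)
Lemma bad_normal (c eps : R) n : enorm n = 1 -> 0 < c <= 1 + dotp n e ->
  0 < eps ->
  eps <= enorm (n - e) -> c * eps ^+ 2 <= 2 * enorm (n - dotp n e *: e) ^+ 2.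
Proof.
move=> /enorm1 nn /andP[c0 cn] eps0.
rewrite -(@ler_pXn2r _ 2)// ?nnegrE ?enorm_ge0 ?(ltW eps0)// !sqr_enorm.
rewrite !dotp_lin nn ee (dotpC e n) => h; nra.
Qed.

Lemma base_le_surface t : (hausdorff_measure d.-1 (base t) <=
  hausdorff_measure d.-1 (cap_surface C r0 e t))%E.
Proof.
have lift x : exists y, base t x ->
    exists2 s, y = x + s *: e & cap_surface C r0 e t y.
  have [Bx|nB] := pselect (base t x); last by exists 0.
  have [Cx xt] := Bx.
  (* Equality in Cauchy-Schwarz: the zeros of [phi] are the line through [x] in direction [e],
     presented as a closed set. The lift of [x] is the highest point of [C] on it. *)
  pose phi y := dotp (y - x) (y - x) - dotp (y - x) e * dotp (y - x) e.
  have phi0 y : phi y = 0 <-> y - x = dotp (y - x) e *: e.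
    have -> : phi y = dotp ((y - x) - dotp (y - x) e *: e) ((y - x) - dotp (y -
      x) e *: e).
      rewrite /phi; move: (y - x) => w.
      by rewrite -[w in RHS]scale1r dotp_scaleB !dotp_lin ee; ring.
    split=> [/eqP|yx]; first by rewrite dotp_eq0 subr_eq0 => /eqP.
    by rewrite -yx subrr dotp0l.
  pose L := C `&` phi @^-1` [set 0].
  have cL : compact L.
    apply: compact_closedI => //.
    apply: (@preimage_closed 'rV[R]_d R phi [set 0]); last exact: closed_eq.
    move=> y _; have cw : continuous (fun y : 'rV[R]_d => y - x).
      by move=> z; exact: cvgB cvg_id (cvg_cst x).
    have c1 := @continuous_dotp _ _ _ _ _ cw cw.
    have c2 := @continuous_dotpl R d x e.
    exact: (cvgB (c1 y) (cvgM (c2 y) (c2 y))).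
  have L0 : L !=set0 by exists x; split => //=; apply/phi0;
    rewrite subrr dotp0l scale0r.
  have [y] := compact_EVT_max L0 cL (continuous_subspaceT (continuous_dotpl
    (r:=r0) (v:=e))).
  rewrite inE => -[Cy /phi0 yx] ymax; exists y => _; exists (dotp (y - x) e).
    by rewrite -yx addrC subrK.
  split; last first.
    have := ymax x; rewrite inE xt; apply; split => //=.
    by apply/phi0; rewrite subrr dotp0l scale0r.
  split; first exact: subset_closure.
  (* An interior point of [C] could be raised further along [e]. *)
  move=> /(interior_absorb e)[s s0 Cys].
  have := ymax (y + s *: e); rewrite inE => h.
  have : ht (y + s *: e) <= ht y.
    apply: h; split => //=; apply/phi0.
    rewrite (_ : _ - x = (y - x) + s *: e); last by rewrite addrAC.
    by rewrite dotpDl dotpZl ee mulr1 scalerDl -yx.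
  rewrite /ht (_ : y + s *: e - r0 = (y - r0) + s *: e); last by rewrite addrAC.
  by rewrite dotpDl dotpZl ee; lra.
have [g gP] := choice lift.
apply: (@hausdorff_measure_expansive _ _ _ _ _ g) => x.
  by move=> /gP[s _].
move=> x' Bx Bx'; have [s -> _] := gP _ Bx; have [s' -> _] := gP _ Bx'.
have xx' : dotp (x - x') e = 0.
  rewrite (_ : x - x' = (x - r0) - (x' - r0));
    last by rewrite opprB addrA subrK.
  by case: Bx => _ /= xt; case: Bx' => _ /= xt';
    rewrite dotpDl dotpNl xt xt' subrr.
rewrite (_ : x + _ - _ = (x - x') + (s - s') *: e); last first.
  by apply/rowP => l; rewrite !mxE; ring.
move: (x - x') xx' => w we; rewrite le_enorm !dotp_lin (dotpC e w) we ee.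
by have := sqr_ge0 (s - s'); rewrite expr2; lra.
Qed.

Lemma closed_homothety_base t (lambda : R) : 0 < lambda ->
  closed (homothety (center t) lambda (base t)).
Proof.
move=> l0; rewrite (_ : homothety _ _ _ =
    (fun x => center t + lambda^-1 *: (x - center t)) @^-1` base t); last first.
  by apply/seteqP; split=> x /homothetyP; rewrite gt_eqF// => /(_ isT).
apply: (@preimage_closed 'rV[R]_d 'rV[R]_d); last first.
  by apply: closedI => //; exact: closed_hyperplane.
by move=> x _; exact: continuous_homothety.
Qed.

(** After division by [|B_t| = b] this says that the total mass lies between [1] and [1 + zeta], and
    that the mass at distance at least [eps] from [e] is at most [zeta]. *)
Lemma cap_estimate (eps zeta : R) : (2 <= d)%N -> 0 < eps -> 0 < zeta ->
  exists2 delta : R, 0 < delta & forall t, 0 < t < delta ->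
  exists2 b : R, 0 < b & [/\ hausdorff_measure d.-1 (base t) = b%:E,
    (b%:E <= surface_area_measure C (cap_surface C r0 e t) setT)%E,
    (surface_area_measure C (cap_surface C r0 e t) setT <= ((1 +
      zeta) * b)%:E)%E &
    (surface_area_measure C (cap_surface C r0 e t) [set n | (eps <= enorm (n -
      e))%R]
      <= (zeta * b)%:E)%E].
Proof.
move=> d2 eps0 zeta0.
have [T T0 CT] := deep_point.
have [c /andP[c0 c1] cP] := normal_height T0 CT.
pose L := 2 / c; have L0 : 0 < L by rewrite divr_gt0.
have cL : 2 <= c * L ^+ 2.
  have -> : c * L ^+ 2 = 2 * L by rewrite /L; field; rewrite gt_eqF.
  by rewrite ler_pMr// ler_pdivlMr//; lra.
have z20 : 0 < zeta / 2 by rewrite divr_gt0.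
have [s [/andP[s0 s1] spow1 spow2]] := power_near1 d.-1 z20.
pose beta := c * eps / 2; have beta0 : 0 < beta by rewrite divr_gt0 ?mulr_gt0.
(* The second summand lets the ball absorb the shift in [flatten_in] with [nu = s / 2]; the third
   gives [s * beta * K > 1] for [flatten_notin], where [beta] bounds from below the horizontal part
   of a normal at distance at least [eps] from [e]. *)
pose K := 1 + 2 * L / s + 1 / (s * beta).
have K1 : 0 < 2 * L / s by rewrite !mulr_gt0 ?invr_gt0.
have K2 : 0 < 1 / (s * beta) by rewrite divr_gt0// mulr_gt0.
have K0 : 0 < K by rewrite /K; lra.
have LK : L <= s / 2 * K.
  have : s / 2 * (2 * L / s) <= s / 2 * K by rewrite ler_pM2l ?divr_gt0// /K;
    lra.
  by rewrite (_ : s / 2 * (2 * L / s) = L)//; field; rewrite gt_eqF.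
have Kbeta : 1 < s * beta * K.
  have sb : 0 < s * beta by rewrite mulr_gt0.
  by rewrite mulrC -ltr_pdivrMr// /K; lra.
have [delta1 delta10 flat] := flat_at_regular K0.
(* The bound [T / 2] keeps the cap in the range of [normal_height]; [T * s / 4] makes
   [T / (T - t) <= 1 + s / 2]. *)
pose delta := Num.min delta1 (Num.min (T / 2) (T * s / 4)).
have delta0 : 0 < delta by rewrite !lt_min delta10 !divr_gt0 ?mulr_gt0.
exists delta => // t /andP[t0]; rewrite !lt_min => /and3P[td1 tT2 tTs].
have ball_t u : dotp u e = 0 -> enorm u <= K * t -> C (center t + u).
  by move=> ue uK; apply: flat => //; rewrite t0.
have Bo : base t (center t).
  split.
    rewrite -[center t]addr0; apply: ball_t; first exact: dotp0l.
    by rewrite enorm0 mulr_ge0 ?(ltW K0) ?(ltW t0).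
  rewrite /= /center (_ : _ - r0 = - (t *: e));
    last by rewrite addrAC subrr add0r.
  by rewrite dotpNl dotpZl ee mulr1.
have tT : 0 < t < T by rewrite t0/=; lra.
have muT : T / (T - t) + s / 2 <= 1 + s.
  have : T / (T - t) <= 1 + s / 2 by rewrite ler_pdivrMr; nra.
  by lra.
have mu0 : 0 < T / (T - t) + s / 2 by rewrite addr_gt0 ?divr_gt0 ?subr_gt0//;
  lra.
set m := d.-1 in spow1 spow2 *.
pose H := @hausdorff_measure R d m.
have cB : compact (base t) by apply: compact_closedI => //;
  exact: closed_hyperplane.
have HB0 : (0 < H (base t))%E.
  apply: (plane_section_gt0 (o := center t) d2 r0e.1 (mulr_gt0 K0 t0) cB) =>
    u ue uK.
  split; first exact: ball_t.
  rewrite /= /center (_ : _ - r0 = u - t *: e); last first.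
    by apply/rowP => l; rewrite !mxE; ring.
  by rewrite dotpDl dotpNl dotpZl ue ee; ring.
have HBoo : (H (base t) < +oo)%E.
  have [M MC] := compact_nat_bound cC.
  apply: (@plane_section_finite _ _ _ e r0 M (- t)) r0e.1 _ _.
    by move=> x i [Cx _]; exact: MC.
  by move=> x [].
have [b HB] : exists b : R, H (base t) = b%:E.
  by exists (fine (H (base t))); rewrite fineK// ge0_fin_numE// ltW.
have b0 : 0 < b by rewrite -lte_fin -HB.
have prop r : cap_surface C r0 e t r -> regular_point C r ->
    [/\ C r, - t <= ht r, unit_normal C r (normal_at C r) &
        c <= 1 + dotp (normal_at C r) e].
  move=> [/(closed_sub_boundary clC) Cr hr] reg.
  have nr := normal_at_unit reg; split => //.
  by apply: (cP r) => //; apply: le_trans hr; rewrite lerN2; lra.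
have big0 : 0 < 1 + s by lra.
have small0 : 0 < 1 - s by lra.
pose big := homothety (center t) (1 + s) (base t).
pose small := homothety (center t) (1 - s) (base t).
have inbig r : cap_surface C r0 e t r -> regular_point C r ->
    big (flatten t r (normal_at C r)).
  move=> Sr reg; have [Cr hr nr cn] := prop _ Sr reg.
  apply: (homothety_base_le Bo mu0 muT).
  apply: (flatten_in (c := c) (K := K) (L := L)) => //; first by rewrite c0.
    exact: ltW.
  by rewrite divr_gt0.
have expansive r r' : cap_surface C r0 e t r -> regular_point C r ->
    cap_surface C r0 e t r' -> regular_point C r' ->
    enorm (r - r') <= enorm (flatten t r (normal_at C r) - flatten t r'
      (normal_at C r')).
  move=> Sr reg Sr' reg'; have [Cr hr nr cn] := prop _ Sr reg.
  have [Cr' hr' nr' cn'] := prop _ Sr' reg'.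
  by apply: flatten_expansive => //; apply: lt_le_trans c0 _.
have Hbig : (H big = ((1 + s) ^+ m * b)%:E)%E.
  by rewrite /H /big hausdorff_measure_homothety// -/H HB.
have Hsmall : (H small = ((1 - s) ^+ m * b)%:E)%E.
  by rewrite /H /small hausdorff_measure_homothety// -/H HB.
exists b => //; split => //.
- rewrite -HB; apply: le_trans (base_le_surface t) _.
  pose reg := [set r | [/\ cap_surface C r0 e t r,
    regular_point C r & setT (normal_at C r)]].
  have sub : cap_surface C r0 e t `<=`
      reg `|` (boundary C `&` [set r | ~ regular_point C r]).
    move=> r Sr; have [regr|nreg] := pselect (regular_point C r); first by left.
    by right; split => //; case: Sr.
  apply: le_trans (le_hausdorff_measure _ sub) _.
  apply: le_trans (outer_measureU2 H _ _) _.
  by rewrite [X in (_ + X)%E](nonregular_null cC conC C0) adde0.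
- apply: (@le_trans _ _ (H big)).
    apply: (@hausdorff_measure_expansive _ _ _ _ _ (fun r =>
      flatten t r (normal_at C r))).
      by move=> r [Sr reg _]; exact: inbig.
    by move=> r r' [Sr reg _] [Sr' reg' _]; exact: expansive.
  rewrite Hbig lee_fin ler_pM2r//; lra.
apply: (@le_trans _ _ (H (big `&` ~` small))).
  apply: (@hausdorff_measure_expansive _ _ _ _ _ (fun r =>
    flatten t r (normal_at C r))).
    move=> r [Sr reg bad]; split; first exact: inbig.
    have [Cr hr nr cn] := prop _ Sr reg.
    apply: (flatten_notin (K := K)) => //; rewrite ?s0//.
      exact: lt_le_trans c0 _.
    have hb := bad_normal nr.1 (_ : 0 < c <= _) eps0 bad.
    have bn : beta <= enorm (normal_at C r - dotp (normal_at C r) e *: e).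
      rewrite -(@ler_pXn2r _ 2)// ?nnegrE ?enorm_ge0 ?(ltW beta0)//.
      have := hb _; rewrite c0 cn => /(_ isT) hb'.
      have : beta ^+ 2 <= c * eps ^+ 2 / 2 by rewrite /beta !expr2; nra.
      by lra.
    by apply: lt_le_trans Kbeta _; rewrite mulrAC ler_pM2l// mulr_gt0.
  by move=> r r' [Sr reg _] [Sr' reg' _]; exact: expansive.
(* Since [small] is closed, it splits the measure of [big] additively, so the bad part has measure
   at most [((1 + s) ^+ m - (1 - s) ^+ m) * b]; each power is within [zeta / 2] of 1. *)
have := @closed_caratheodory R d m small (closed_homothety_base (t :=
  t) small0) big.
rewrite -/H (_ : big `&` small = small); last first.
  by apply/setIidPr => x; apply: homothety_base_le => //; lra.
rewrite -/H Hbig Hsmall.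
case: (H (big `&` ~` small)) => [x| |]//.
rewrite -EFinD => -[hx]; rewrite lee_fin.
rewrite (_ : x = ((1 + s) ^+ m - (1 - s) ^+ m) * b);
  last by rewrite mulrBl hx; ring.
by rewrite ler_pM2r//; lra.
Qed.

End cap.

(** * Weak convergence *)

Section surface_measure.
Context {R : realType} {d : nat}.
Variables (C S : set 'rV[R]_d).
Hypotheses (cC : compact C) (conC : convex_set C) (C0 : interior C !=set0).
Hypotheses (clS : closed S) (SC : S `<=` boundary C).

Let H := @hausdorff_measure R d d.-1.
Let part (A : set (borel_rV R d)) : set 'rV[R]_d :=
  [set r | [/\ S r, regular_point C r & A (normal_at C r)]].

Let part_setT : H.-caratheodory (part setT).
Proof.
have -> : part setT = S `\` (boundary C `&` [set r | ~ regular_point C r]).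
  apply/seteqP; split=> r; first by move=> [Sr reg _];
    split => // -[_ /(_ reg)].
  move=> [Sr h]; split => //; apply: contrapT => nreg; apply: h; split => //.
  exact: SC.
apply: caratheodory_measurable_setD; first exact: closed_caratheodory.
by apply: null_caratheodory; exact: nonregular_null.
Qed.

(** The sets [A] with this property form a sigma-algebra. For an open [U], the points whose normal
    avoids [U] are the regular ones admitting a normal in the compact set [Z], and those admitting
    one form a closed set. *)
Lemma caratheodory_normals (A : set (borel_rV R d)) : measurable A ->
  (@hausdorff_measure R d d.-1).-caratheodory
    [set r | [/\ S r, regular_point C r & A (normal_at C r)]].
Proof.
move: A; apply: smallest_sub.
  split.
  - change (H.-caratheodory (part set0)).
    rewrite (_ : part set0 = set0); first exact: caratheodory_measurable_set0.
    by rewrite -subset0 => r [].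
  - move=> A mA; rewrite (_ : [set r | _] = part setT `\` part A).
      exact: caratheodory_measurable_setD.
    apply/seteqP; split=> r; first by move=> [Sr reg [_ nA]]; split => // -[].
    by move=> [[Sr reg _] nA]; split => //; split => // Ar; apply: nA.
  - move=> F mF; rewrite (_ : [set r | _] = \bigcup_k part (F k)).
      exact: caratheodory_measurable_bigcup.
    apply/seteqP; split=> r; first by move=> [Sr reg [k _ Fk]]; exists k.
    by move=> [k _ [Sr reg Fk]]; split => //; exists k.
move=> U oU; pose Z := @usphere R d `&` ~` U.
have cZ : compact Z.
  by apply: compact_closedI; [exact: compact_usphere|exact: open_closedC].
rewrite (_ : [set r | _] =
    part setT `\` [set p | exists2 n, Z n & C `<=` halfspace p n]).
  apply: caratheodory_measurable_setD => //; apply: closed_caratheodory.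
  exact: closed_normals.
apply/seteqP; split=> r.
  move=> [Sr reg Un]; split => // -[n [n1 nUn] Cn]; apply: nUn.
  by rewrite (regular_unit_normal_inj C0 reg (conj n1 Cn) (normal_at_unit reg)).
move=> [[Sr reg _] nh]; split => //; apply: contrapT => nU; apply: nh.
by have [n1 Cn] := normal_at_unit reg; exists (normal_at C r).
Qed.

Let sigma : set (borel_rV R d) -> \bar R := surface_area_measure C S.

Let sigma0 : sigma set0 = 0%E.
Proof.
rewrite /sigma /surface_area_measure (_ : [set r | _] = set0).
  exact: hausdorff_measure0.
by rewrite -subset0 => r [].
Qed.

Let sigma_ge0 A : (0 <= sigma A)%E.
Proof. exact: hausdorff_measure_ge0. Qed.

Let sigma_semi_sigma_additive : semi_sigma_additive sigma.
Proof.
move=> F mF tF mUF.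
have := @caratheodory_measure_sigma_additive R 'rV[R]_d
  (@hausdorff_measure R d d.-1 : {outer_measure set _ ->
    \bar R}) (fun k => part (F k)).
have mP k : (@hausdorff_measure R d d.-1).-caratheodory (part (F k)).
  exact: caratheodory_normals.
move=> /(_ mP).
have tP : trivIset setT (fun k => part (F k)).
  apply/trivIsetP => i j _ _ ij; rewrite -subset0 => r [[_ _ Fi] [_ _ Fj]].
  by have /trivIsetP/(_ i j Logic.I Logic.I ij) := tF;
    rewrite -subset0 => /(_ _ (conj Fi Fj)).
move=> /(_ tP (caratheodory_measurable_bigcup mP)).
rewrite /sigma /surface_area_measure (_ : [set r | _] = \bigcup_k part (F k))//.
apply/seteqP; split=> r; first by move=> [Sr reg [k _ Fk]]; exists k.
by move=> [k _ [Sr reg Fk]]; split => //; exists k.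
Qed.

(** The statement of weak convergence integrates against a bare function; this equality lets that
    function be replaced by a measure, for which the theory of integration is available. *)
Lemma surface_area_measure_is_measure :
  exists mu : {measure set (borel_rV R d) -> \bar R},
    (mu : set (borel_rV R d) -> \bar R) = surface_area_measure C S.
Proof.
pose M := isMeasure.Build _ _ _ sigma sigma0 sigma_ge0
  sigma_semi_sigma_additive.
pose mu : {measure set (borel_rV R d) -> \bar R} := HB.pack sigma M.
by exists mu.
Qed.

End surface_measure.

(** * Integrals against measures concentrated near a point *)

Section concentration.
Context {R : realType} {d : nat}.

Lemma measurable_closed_rV (A : set 'rV[R]_d) : closed A ->
  measurable (A : set (borel_rV R d)).
Proof.
move=> cA; rewrite -(setCK A); apply: measurableC.
by apply: sub_sigma_algebra; exact: closed_openC.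
Qed.

Lemma closed_usphere : closed (@usphere R d).
Proof.
by apply: compact_closed; [exact: norm_hausdorff|exact: compact_usphere].
Qed.

Lemma within_continuous_measurable_rV (D : set 'rV[R]_d) (f : 'rV[R]_d -> R) :
  closed D -> {within D, continuous f} ->
  measurable_fun (D : set (borel_rV R d)) f.
Proof.
move=> cD /continuousP cf mD; apply: (measurability _ (RGenOpens.measurableE
  R)) => //.
move=> _ [_ [a [b ->] <-]].
have /open_subspaceP[V oV VD] : open (f @^-1` `]a,
  b[%classic : set (subspace D)).
  exact/cf/interval_open.
rewrite setIC -VD; apply: measurableI => //; exact: sub_sigma_algebra.
Qed.

(** With [m] the mass of the sphere, [g - f e] is [g - f e * m], the integral of [f - f e], plus
    [f e * (m - 1)]. The first is bounded through the majorant [eta + 2 * M * 1_Z], the second by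
    [M * zeta]. *)
Lemma integral_concentrated (mu : {measure set (borel_rV R d) -> \bar R})
    (f : 'rV[R]_d -> R) (e : 'rV[R]_d) (M eps eta zeta : R) :
  measurable_fun (@usphere R d : set (borel_rV R d)) f -> usphere e ->
  (forall n, usphere n -> `|f n| <= M) -> 0 <= eta ->
  (forall n, usphere n -> enorm (n - e) < eps -> `|f n - f e| <= eta) ->
  (1 <= mu (@usphere R d) <= (1 + zeta)%:E)%E ->
  (mu [set n | (eps <= enorm (n - e))%R] <= zeta%:E)%E ->
  exists g : R, (\int[mu]_(n in @usphere R d) (f n)%:E = g%:E)%E /\
    `|g - f e| <= 3 * M * zeta + eta * (1 + zeta).
Proof.
move=> mf De fM eta0 feta /andP[mass1 mass2] massZ.
pose D : set (borel_rV R d) := @usphere R d.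
pose Z : set (borel_rV R d) := [set n | eps <= enorm (n - e)].
have mD : measurable D by exact: measurable_closed_rV closed_usphere.
have mZ : measurable Z.
  apply: measurable_closed_rV.
  apply: (@preimage_closed 'rV[R]_d R (fun n =>
    enorm (n - e)) [set t : R | eps <= t]); last exact: closed_ge.
  move=> n _; have cn : {for n, continuous (fun n : 'rV[R]_d => n - e)}.
    exact: cvgB cvg_id (cvg_cst e).
  exact: (continuous_comp cn (@continuous_enorm R d _)).
have M0 : 0 <= M by apply: le_trans (fM _ De).
have zeta0 : 0 <= zeta.
  by rewrite -lee_fin; apply: le_trans massZ; exact: measure_ge0.
have [m muD] : exists m : R, mu D = m%:E.
  exists (fine (mu D)); rewrite fineK// ge0_fin_numE ?measure_ge0//.
  by apply: le_lt_trans mass2 _; exact: ltry.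
have Doo : (mu D < +oo)%E by rewrite muD ltry.
have /andP[m1 m2] : 1 <= m <= 1 + zeta.
  by move: mass1 mass2; rewrite -/D muD !lee_fin => -> ->.
have intf : mu.-integrable D (EFin \o f).
  apply: measurable_bounded_integrable => //.
  by exists M; split; [exact: num_real|] => x Mx n /= Dn;
    apply: le_trans (fM _ Dn) _; exact: ltW.
have intc : mu.-integrable D (EFin \o cst (f e)).
  apply: measurable_bounded_integrable => //.
  by exists `|f e|; split; [exact: num_real|] => x Mx n /= Dn; exact: ltW.
have ef := integrable_fin_num mD intf.
pose g := fine (\int[mu]_(n in D) (f n)%:E)%E.
have gE : (\int[mu]_(n in D) (f n)%:E = g%:E)%E by rewrite fineK.
exists g; split => //.
have diff : (\int[mu]_(n in D) (f n - f e)%:E = (g - f e * m)%:E)%E.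
  have := integralB_EFin mD intf intc.
  under eq_integral do rewrite -EFinB.
  move=> ->; rewrite gE EFinB; congr (_ - _)%E.
  by have := integral_cst mu mD (f e)%:E; rewrite muD -EFinM.
have mfe : measurable_fun D (fun n => f n - f e) by apply: measurable_funB.
have measurable_scaled_indic : measurable_fun D (fun n =>
  (2 * M)%:E * (\1_Z n)%:E)%E.
  by apply/measurable_EFinP; apply: measurable_funM.
have measurable_majorant :
    measurable_fun D (fun n => eta%:E + (2 * M)%:E * (\1_Z n)%:E)%E.
  by apply/measurable_EFinP; apply: measurable_funD => //;
    apply: measurable_funM.
have : (`|(g - f e * m)%:E| <= (eta * m + 2 * M * zeta)%:E)%E.
  rewrite -diff; apply: le_trans (le_abse_integral _ mD _) _.
    exact/measurable_EFinP.
  apply: (@le_trans _ _ (\int[mu]_(n in D) (eta%:E +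
    (2 * M)%:E * (\1_Z n)%:E))%E).
    apply: ge0_le_integral => //.
    - exact/measurable_EFinP/measurableT_comp.
    - move=> n Dn; rewrite abse_EFin -EFinM -EFinD lee_fin.
      have [nZ|nZ] := pselect (Z n).
        rewrite indicE mem_set//= mulr1.
        apply: le_trans (ler_normB _ _) _.
        by have := fM _ Dn; have := fM _ De; lra.
      rewrite indicE memNset//= mulr0 addr0; apply: feta => //.
      by rewrite ltNge; apply/negP.
  rewrite ge0_integralD//; last by move=> n _;
    rewrite mule_ge0 ?lee_fin ?mulr_ge0.
  rewrite (integral_cst mu mD eta%:E) muD ge0_integralZl_EFin//; last 2 first.
  - exact/measurable_EFinP.
  - by rewrite mulr_ge0.
  rewrite integral_indic// EFinD; apply: leeD; first by rewrite EFinM.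
  rewrite (EFinM (2 * M)); apply: lee_wpmul2l;
    first by rewrite lee_fin mulr_ge0.
  by apply: le_trans massZ; apply: le_measure; rewrite ?inE//;
    exact: measurableI.
rewrite abse_EFin lee_fin => h.
rewrite (_ : g - f e = (g - f e * m) + f e * (m - 1)); last by ring.
apply: le_trans (ler_normD _ _) _; rewrite (normrM (f e)).
have : `|f e| * `|m - 1| <= M * zeta.
  apply: ler_pM => //; first exact: fM.
  by rewrite ger0_norm; lra.
have : eta * m <= eta * (1 + zeta) by rewrite ler_wpM2l.
lra.
Qed.

End concentration.

Theorem theorem1 (R : realType) (d : nat) (hd : (2 <= d)%N)
    (C : set 'rV[R]_d) (hC : convex_body C)
    (r0 : 'rV[R]_d) (hr0 : regular_point C r0)
    (Pi : set 'rV[R]_d) (hPi : support_plane C r0 Pi)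
    (e : 'rV[R]_d) (he : outward_unit_normal C r0 Pi e) :
  sphere_weak_cvg (normalized_cap_measure C r0 e) (dirac (e : borel_rV R d)).
Proof.
have [cC conC C0] := hC.
have r0e : unit_normal C r0 e by case: he.
have clC : closed C by apply: compact_closed => //; exact: norm_hausdorff.
move=> f cf; pose D : set (borel_rV R d) := @usphere R d.
have mD : measurable D by exact: measurable_closed_rV closed_usphere.
have mf : measurable_fun D f.
  by apply: within_continuous_measurable_rV => //; exact: closed_usphere.
have De : D e by case: r0e.
rewrite integral_dirac//; last exact/measurable_EFinP.
rewrite diracE mem_set// mul1e.
have [M M0 fM] : exists2 M : R, 0 <= M & forall n, usphere n -> `|f n| <= M.
  have [M [_ fM]] := compact_bounded (continuous_compact cf (@compact_usphere R
    d)).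
  exists (`|M| + 1); first by rewrite addr_ge0.
  move=> n Dn; apply: (fM (`|M| + 1)); last by exists n.
  by rewrite (le_lt_trans (ler_norm M))// ltrDl.
have key eta : 0 < eta -> exists2 delta : R, 0 < delta & forall t,
  0 < t < delta ->
    exists g : R,
      (\int[normalized_cap_measure C r0 e t]_(n in D) (f n)%:E = g%:E)%E /\
      `|g - f e| <= eta.
  move=> eta0.
  have [eps eps0 feps] : exists2 eps : R, 0 < eps & forall n, usphere n ->
      enorm (n - e) < eps -> `|f n - f e| <= eta / 4.
    have e40 : 0 < eta / 4 by rewrite divr_gt0.
    have /cvgrPdist_le/(_ _ e40) := (subspace_continuousP _ _).1 cf e De.
    rewrite near_withinE => /nbhs_ballP[rho /= rho0 h];
      exists rho => // n Dn ne.
    rewrite distrC; apply: h => //; rewrite -ball_normE /= distrC.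
    exact: le_lt_trans (norm_le_enorm _) ne.
  (* Makes [3 * M * zeta <= eta / 2]; the other error [eta / 4 * (1 + zeta)] is at most [eta / 2]
     because [zeta <= 1]. *)
  pose zeta := Num.min 1 (eta / (6 * (M + 1))).
  have zeta0 : 0 < zeta.
    by rewrite lt_min ltr01 divr_gt0// mulr_gt0// ltr_wpDl.
  have zeta1 : zeta <= 1 by rewrite ge_min lexx.
  have Mzeta : 3 * M * zeta <= eta / 2.
    have : zeta * (6 * (M + 1)) <= eta.
      by rewrite -ler_pdivlMr ?mulr_gt0 ?ltr_wpDl// ge_min lexx orbT.
    by nra.
  have [delta delta0 est] := cap_estimate cC conC C0 hr0 r0e hd eps0 zeta0.
  exists delta => // t /est[b b0 [HB low up bad]].
  pose S := cap_surface C r0 e t.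
  have clS : closed S.
    apply: closedI; last exact: closed_halfspace_ge.
    apply: closedI; first exact: closed_closure.
    apply: open_closedC; exact: open_interior.
  have [mu muE] := @surface_area_measure_is_measure _ _ C S cC conC C0 clS
    (@subIsetl _ _ _).
  have binv0 : 0 <= b^-1 by rewrite invr_ge0 ltW.
  pose nu := mscale (NngNum binv0) mu.
  have nuE : normalized_cap_measure C r0 e t = nu.
    apply/funext => A; rewrite /normalized_cap_measure HB /nu /mscale muE /=.
    by rewrite inver gt_eqF.
  (* Normals at regular points are unit vectors, so the whole mass sits on the sphere. *)
  have surfD : surface_area_measure C S D = surface_area_measure C S setT.
    rewrite /surface_area_measure; congr hausdorff_measure.
    apply/seteqP; split=> r [Sr reg _]; split => //.
    by have [] := normal_at_unit reg.
  rewrite nuE.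
  have [] := @integral_concentrated _ _ nu f e M eps (eta / 4) zeta mf De fM _
    feps.
  - by rewrite divr_ge0// ltW.
  - rewrite /nu /= /mscale muE -/D surfD /=; apply/andP; split.
      by rewrite lee_pdivlMl// mule1.
    by rewrite lee_pdivrMl// -EFinM mulrC.
  - by rewrite /nu /= /mscale muE /= lee_pdivrMl// -EFinM mulrC.
  move=> g [gE gle]; exists g; split => //; apply: le_trans gle _.
  nra.
(* The integrals are extended reals: [key] with [eta = 1] shows that they are finite for small [t],
   after which convergence is tested in the reals. *)
apply/fine_cvgP; split.
  have [delta delta0 h] := key _ ltr01.
  near=> t; have [|g [-> _]//] := h t.
  by apply/andP; split; near: t; [exact: nbhs_right_gt|exact: nbhs_right_lt].
apply/cvgrPdist_le => eta eta0; have [delta delta0 h] := key _ eta0.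
near=> t; have [|g [gE gle]] := h t.
  by apply/andP; split; near: t; [exact: nbhs_right_gt|exact: nbhs_right_lt].
by rewrite /= gE /= distrC.
Unshelve. all: by end_near.
Qed.
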